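(* Let $X$ be a separable infinite-dimensional Banach space. Then for each $\mathcal{I}\in\{\mathcal{B},\mathcal{P}_\infty,\mathcal{P}\}$, \[\{\mu\in\mathcal{I}: X_\mu\equiv\ell_2\}\subseteq\overline{\{\mu\in\mathcal{I}: X_\mu\equiv X\}}\cap\mathcal{I}.\]
   Context: Banach spaces are real; $\equiv$ denotes linear isometry of Banach spaces; closures are taken in $\mathcal{P}$. $V$ is the $\mathbb{Q}$-vector space of finitely supported sequences of rational numbers with canonical basis $(e_n)_{n\in\mathbb{N}}$, and $c_{00}\supseteq V$ is the real vector space of finitely supported real sequences. $\mathcal{P}$ is the set of all pseudonorms (seminorms) on $V$, with the topology inherited from $\mathbb{R}^V$ (pointwise convergence). Each $\mu\in\mathcal{P}$ is identified with its extension to a pseudonorm on $c_{00}$. $X_\mu$ is the Banach space obtained as the completion of the quotient of $(c_{00},\mu)$ by $\{x\in c_{00}:\mu(x)=0\}$. $\mathcal{P}_\infty$ is the set of $\mu\in\mathcal{P}$ with $X_\mu$ infinite-dimensional, and $\mathcal{B}$ is the set of those $\mu\in\mathcal{P}_\infty$ whose extension to $c_{00}$ is a norm. *)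

(* Defs.v *)
From HB Require Import structures.
From mathcomp Require Import all_boot all_order all_algebra.
From mathcomp Require Import ring_quotient ring.
From mathcomp Require Import all_classical all_reals all_analysis.

Set Implicit Arguments.
Unset Strict Implicit.
Unset Printing Implicit Defensive.

Import Order.TTheory GRing.Theory Num.Theory.
Import numFieldNormedType.Exports.

Local Open Scope classical_set_scope.
Local Open Scope ring_scope.
Local Open Scope quotient_scope.

Record seminorm (R : realType) (E : lmodType R) := Seminorm {
  seminorm_fun :> E -> R;
  seminorm_ge0 : forall x, 0 <= seminorm_fun x;
  seminormZ : forall a x, seminorm_fun (a *: x) = `|a| * seminorm_fun x;
  seminormD : forall x y, seminorm_fun (x + y) <= seminorm_fun x + seminorm_fun y
}.

Section SeminormTheory.
Context (R : realType) (E : lmodType R) (p : seminorm E).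

Lemma seminorm0 : p 0 = 0.
Proof. by rewrite -(scale0r (0 : E)) seminormZ normr0 mul0r. Qed.

Lemma seminormN x : p (- x) = p x.
Proof. by rewrite -scaleN1r seminormZ normrN1 mul1r. Qed.

Lemma seminorm_distC x y : p (x - y) = p (y - x).
Proof. by rewrite -seminormN opprB. Qed.

Lemma seminorm_triangle z x y : p (x - y) <= p (x - z) + p (z - y).
Proof. by have := seminormD p (x - z) (z - y); rewrite addrA subrK. Qed.

Lemma seminorm_dist x y : `|p x - p y| <= p (x - y).
Proof.
rewrite ler_norml; apply/andP; split.
  rewrite lerNl opprB lerBlDr seminorm_distC.
  by have := seminormD p (y - x) x; rewrite subrK.
by rewrite lerBlDr; have := seminormD p (x - y) y; rewrite subrK.
Qed.

End SeminormTheory.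

(* The completion of (E, p) modulo {x | p x = 0}, in one step: p-Cauchy
   sequences of E modulo the sequences u such that p (u n) --> 0. *)
Section CauchySequences.
Context (R : realType) (E : lmodType R) (p : seminorm E).

Definition seminorm_cauchy (u : nat -> E) :=
  forall e : R, 0 < e ->
    exists N, forall m n, (N <= m)%N -> (N <= n)%N -> p (u m - u n) < e.

Definition cauchy_pred : {pred (nat -> E)} := fun u => `[< seminorm_cauchy u >].

Lemma cauchy_pred_submod : submod_closed cauchy_pred.
Proof.
split.
  apply/asboolP => e e0; exists 0%N => m n _ _.
  by rewrite [X in p X](_ : _ = 0) ?seminorm0// subr0.
move=> a u v /asboolP cu /asboolP cv; apply/asboolP => e e0.
have a0 : 0 < `|a| + 1 by rewrite ltr_pwDr.
have [N hN] := cu (e / 2 / (`|a| + 1)) ltac:(by rewrite !divr_gt0).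
have [M hM] := cv (e / 2) ltac:(by rewrite divr_gt0).
exists (maxn N M) => m n; rewrite !geq_max => /andP[Nm Mm] /andP[Nn Mn].
rewrite [X in p X](_ : _ = a *: (u m - u n) + (v m - v n)); last first.
  by rewrite scalerBr addrACA opprD.
rewrite (le_lt_trans (seminormD _ _ _))// [ltRHS]splitr ler_ltD ?hM//.
rewrite seminormZ (@le_trans _ _ ((`|a| + 1) * p (u m - u n)))//.
  by rewrite ler_wpM2r ?seminorm_ge0// lerDl.
by rewrite mulrC -ler_pdivlMr// ltW// hN.
Qed.

HB.instance Definition _ :=
  GRing.isSubmodClosed.Build R (nat -> E) cauchy_pred cauchy_pred_submod.

Record cauchySeq := CauchySeq {
  cauchySeq_val :> nat -> E;
  cauchySeqP : cauchySeq_val \in cauchy_pred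
}.

HB.instance Definition _ := [isSub for cauchySeq_val].
HB.instance Definition _ := [Choice of cauchySeq by <:].
HB.instance Definition _ := [SubChoice_isSubLmodule of cauchySeq by <:].

Lemma cauchySeq_cvg (u : cauchySeq) : cvgn (p \o u).
Proof.
apply: R_complete; apply: cauchy_exP => e e0.
have /asboolP/(_ _ e0)[N hN] := cauchySeqP u.
exists (p (u N)); exists N => // n Nn; rewrite /ball/=.
by apply: le_lt_trans (seminorm_dist p (u N) (u n)) _; exact: hN.
Qed.

Definition null_pred : {pred cauchySeq} :=
  fun u => `[< p \o u @ \oo --> (0 : R) >].

Lemma null_predP (u : cauchySeq) :
  reflect (p \o u @ \oo --> (0 : R)) (u \in null_pred).
Proof. exact: asboolP. Qed.

Lemma null_pred_submod : submod_closed null_pred.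
Proof.
split.
  apply/null_predP; rewrite (_ : p \o _ = cst 0); first exact: cvg_cst.
  by apply/funext => n /=; rewrite seminorm0.
move=> a u v /null_predP cu /null_predP cv; apply/null_predP.
apply: (@squeeze_cvgr _ _ _ _ (cst 0) (fun n => `|a| * p (u n) + p (v n))).
- near=> n; rewrite seminorm_ge0/=.
  by rewrite (le_trans (seminormD _ _ _))// seminormZ.
- exact: cvg_cst.
- rewrite -[X in _ --> X](addr0 (0 : R)) -{1}(mulr0 `|a|).
  by apply: cvgD => //; apply: cvgMr.
Unshelve. all: by end_near. Qed.

HB.instance Definition _ :=
  GRing.isSubmodClosed.Build R cauchySeq null_pred null_pred_submod.

Definition completion : Type := Quotient.quot null_pred.
HB.instance Definition _ := GRing.Zmodule.on completion.
HB.instance Definition _ := EqQuotient.on completion.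

Definition cclass (u : cauchySeq) : completion := \pi_(Quotient.quot null_pred) u.

Lemma cclassP (q : completion) : exists u, q = cclass u.
Proof. by exists (repr q); rewrite /cclass reprK. Qed.

Lemma cclass_eq (u v : cauchySeq) :
  cclass u = cclass v <-> u - v \in null_pred.
Proof. by rewrite (rwP eqP) /cclass -Quotient.idealrBE. Qed.

Lemma cclassD (u v : cauchySeq) : cclass (u + v) = cclass u + cclass v.
Proof. exact: raddfD. Qed.

Lemma cclassN (u : cauchySeq) : cclass (- u) = - cclass u.
Proof. exact: raddfN. Qed.

Lemma cclassB (u v : cauchySeq) : cclass (u - v) = cclass u - cclass v.
Proof. exact: raddfB. Qed.

Lemma repr_cclass (u : cauchySeq) : repr (cclass u) - u \in null_pred.
Proof. by apply/cclass_eq; rewrite /cclass reprK. Qed.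

Definition completion_scale (a : R) (q : completion) : completion :=
  cclass (a *: repr q).

Lemma completion_scaleE a u : completion_scale a (cclass u) = cclass (a *: u).
Proof. by apply/cclass_eq; rewrite -scalerBr rpredZ// repr_cclass. Qed.

Lemma completion_scaleA a b q :
  completion_scale a (completion_scale b q) = completion_scale (a * b) q.
Proof. by have [u ->] := cclassP q; rewrite !completion_scaleE scalerA. Qed.

Lemma completion_scale1 : left_id 1 completion_scale.
Proof. by move=> q; have [u ->] := cclassP q; rewrite completion_scaleE scale1r. Qed.

Lemma completion_scaleDr : right_distributive completion_scale +%R.
Proof.
move=> a q r; have [u ->] := cclassP q; have [v ->] := cclassP r.
by rewrite -cclassD !completion_scaleE -cclassD scalerDr.
Qed.

Lemma completion_scaleDl q : {morph completion_scale^~ q : a b / a + b}.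
Proof.
move=> a b; have [u ->] := cclassP q.
by rewrite !completion_scaleE -cclassD scalerDl.
Qed.

HB.instance Definition _ := GRing.Zmodule_isLmodule.Build R completion
  completion_scaleA completion_scale1 completion_scaleDr completion_scaleDl.

Lemma cclassZ a (u : cauchySeq) : cclass (a *: u) = a *: cclass u.
Proof. by rewrite -completion_scaleE. Qed.

Definition completion_norm (q : completion) : R := limn (p \o repr q).

Lemma completion_normE (u : cauchySeq) :
  completion_norm (cclass u) = limn (p \o u).
Proof.
pose w := repr (cclass u) - u.
have /null_predP w0 : w \in null_pred by exact: repr_cclass.
apply/esym/cvg_lim => //.
pose f : R ^nat := p \o repr (cclass u); pose g : R ^nat := p \o u.
rewrite -/f -/g (_ : g = f + (g - f)); last by rewrite addrC subrK.
rewrite -[X in _ --> X]addr0; apply: cvgD; first exact: cauchySeq_cvg.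
apply: norm_cvg0; apply: squeeze_cvgr (cvg_cst 0) w0.
near=> n; rewrite normr_ge0/= /g /f/=.
by apply: le_trans (seminorm_dist _ _ _) _; rewrite seminorm_distC.
Unshelve. all: by end_near. Qed.

Lemma completion_normD q r :
  completion_norm (q + r) <= completion_norm q + completion_norm r.
Proof.
have [u ->] := cclassP q; have [v ->] := cclassP r.
rewrite -cclassD !completion_normE.
rewrite -limD; [|exact: cauchySeq_cvg..].
apply: ler_lim; [exact: cauchySeq_cvg| |].
  by apply: is_cvgD; exact: cauchySeq_cvg.
by near=> n; exact: seminormD.
Unshelve. all: by end_near. Qed.

Lemma completion_normZ a q :
  completion_norm (a *: q) = `|a| * completion_norm q.
Proof.
have [u ->] := cclassP q; rewrite -cclassZ !completion_normE.
apply/cvg_lim => //; rewrite (_ : p \o _ = (fun n => `|a| * (p \o u) n)).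
  by apply: cvgMr; exact: cauchySeq_cvg.
by apply/funext => n; exact: seminormZ.
Qed.

Lemma completion_norm_eq0 q : completion_norm q = 0 -> q = 0.
Proof.
have [u ->] := cclassP q; rewrite completion_normE => u0.
have <- : cclass 0 = 0 by exact: raddf0.
apply/cclass_eq/null_predP; rewrite subr0 -u0; exact: cauchySeq_cvg.
Qed.

HB.instance Definition _ := Lmodule_isNormed.Build R completion
  completion_normD completion_normZ completion_norm_eq0.

Lemma cclass_norm (u : cauchySeq) : `|cclass u| = limn (p \o u).
Proof. exact: completion_normE. Qed.

Lemma cst_cauchy (x : E) : cst x \in cauchy_pred.
Proof.
by apply/asboolP => e e0; exists 0%N => m n _ _; rewrite subrr seminorm0.
Qed.

Definition completion_in (x : E) : completion := cclass (CauchySeq (cst_cauchy x)).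

Lemma completion_in_linear : linear completion_in.
Proof. by move=> a x y; rewrite -cclassZ -cclassD; congr cclass; exact: val_inj. Qed.

HB.instance Definition _ :=
  GRing.isLinear.Build R E completion _ completion_in completion_in_linear.

Lemma completion_in_norm x : `|completion_in x| = p x.
Proof.
rewrite cclass_norm (_ : p \o _ = cst (p x)) ?lim_cst//.
Qed.

Lemma completion_in_cvg (u : cauchySeq) : completion_in (u n) @[n --> \oo] --> cclass u.
Proof.
apply/cvgrPdist_le => e e0.
have /asboolP/(_ _ e0)[N hN] := cauchySeqP u.
near=> n; rewrite /completion_in -cclassB cclass_norm.
apply: limr_le; first exact: cauchySeq_cvg.
near=> m; apply/ltW/hN.
  by near: m; exact: nbhs_infty_ge.
by near: n; exact: nbhs_infty_ge.
Unshelve. all: by end_near. Qed.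

Lemma completion_in_dense (q : completion) e : 0 < e ->
  exists x, `|q - completion_in x| < e.
Proof.
move=> e0; have [u ->] := cclassP q.
have /cvgrPdist_lt/(_ _ e0)[N _ hN] := @completion_in_cvg u.
by exists (u N); apply: (hN N); rewrite /= leqnn.
Qed.

Lemma completion_complete (F : set_system completion) :
  ProperFilter F -> cauchy F -> cvg F.
Proof.
move=> FF /cauchyP Fc.
have e_gt0 n : 0 < n.+1%:R^-1 :> R by [].
have /choice[x hx] : forall n, exists x : E,
    F (ball (completion_in x) (n.+1%:R^-1)).
  move=> n.
  have e2 : 0 < (n.+1%:R^-1 : R) / 2 by rewrite divr_gt0.
  have [q Fq] := Fc _ e2; have [x qx] := completion_in_dense q e2.
  exists x; apply: filterS Fq => r qr.
  by apply: (@ball_splitr _ _ q); rewrite -ball_normE// in qr *.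
have xc : x \in cauchy_pred.
  apply/asboolP => e e0.
  have [N _ hN] : \forall n \near \oo, (n.+1%:R^-1 : R) < e / 2.
    by apply: near_infty_natSinv_lt (PosNum _); rewrite divr_gt0.
  exists N => m n Nm Nn; rewrite -completion_in_norm linearB/=.
  have [r [xmr xnr]] := filter_ex (filterI (hx m) (hx n)).
  rewrite -!ball_normE/= in xmr xnr.
  rewrite (le_lt_trans (ler_distD r _ _))// [ltRHS]splitr ltrD//.
    by rewrite (lt_trans xmr)//; exact: hN.
  by rewrite distrC (lt_trans xnr)//; exact: hN.
apply/cvg_ex; exists (cclass (CauchySeq xc)).
apply/cvgrPdist_lt => e e0.
have e2 : 0 < e / 2 by rewrite divr_gt0.
have [n [n1 n2]] : exists n, (n.+1%:R^-1 : R) < e / 2 /\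
    `|cclass (CauchySeq xc) - completion_in (x n)| < e / 2.
  have := @completion_in_cvg (CauchySeq xc).
  move=> /cvgrPdist_lt/(_ _ e2) near1.
  have near2 : \forall n \near \oo, (n.+1%:R^-1 : R) < e / 2.
    by apply: near_infty_natSinv_lt (PosNum e2).
  by have [n []] := filter_ex (filterI near1 near2); exists n.
apply: filterS (hx n) => r; rewrite -ball_normE/= => xr.
rewrite (le_lt_trans (ler_distD (completion_in (x n)) _ _))// [ltRHS]splitr.
by rewrite ltrD// (lt_trans xr).
Qed.

HB.instance Definition _ := Uniform_isComplete.Build completion completion_complete.

End CauchySequences.

Definition isometric (R : realType) (E F : normedModType R) :=
  exists T : {linear E -> F}, bijective T /\ forall x, `|T x| = `|x|.

Definition separable (T : topologicalType) :=
  exists D : set T, countable D /\ dense D.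

Definition infinite_dimensional (R : realType) (E : lmodType R) :=
  ~ exists n (e : 'I_n -> E), forall x,
      exists a : 'I_n -> R, x = \sum_(i < n) a i *: e i.

Section Ell2.
Context (R : realType).

Definition ell2_pred : {pred (nat -> R)} :=
  fun x => `[< cvgn (series (fun k => x k ^+ 2)) >].

Lemma ell2_pred_submod : submod_closed ell2_pred.
Proof.
split.
  apply/asboolP; rewrite (_ : series _ = cst 0); first exact: is_cvg_cst.
  apply/funext => n; rewrite /series/= big1// => k _.
  by rewrite expr0n.
move=> a x y /asboolP cx /asboolP cy; apply/asboolP.
have c2 : cvgn (series ((2 * a ^+ 2) *: (fun k => x k ^+ 2 : R) +
                        2 *: (fun k => y k ^+ 2 : R))).
  by apply: is_cvg_seriesD; apply: is_cvg_seriesZ.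
apply: series_le_cvg c2 => n; first exact: sqr_ge0.
  apply: addr_ge0; (apply: mulr_ge0; last exact: sqr_ge0) => //.
  by apply: mulr_ge0; rewrite ?sqr_ge0.
rewrite -subr_ge0 [leRHS](_ : _ = (a * x n - y n) ^+ 2) ?sqr_ge0//.
rewrite !fctE /GRing.scale/=; ring.
Qed.

HB.instance Definition _ :=
  GRing.isSubmodClosed.Build R (nat -> R) ell2_pred ell2_pred_submod.

Record ell2 := Ell2 {
  ell2_val :> nat -> R;
  ell2P : ell2_val \in ell2_pred
}.

HB.instance Definition _ := [isSub for ell2_val].
HB.instance Definition _ := [Choice of ell2 by <:].
HB.instance Definition _ := [SubChoice_isSubLmodule of ell2 by <:].

Definition ell2_norm (x : ell2) : R :=
  Num.sqrt (limn (series (fun k => x k ^+ 2))).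

Lemma ell2_cvg (x : ell2) : cvgn (series (fun k => x k ^+ 2)).
Proof. by have /asboolP := ell2P x. Qed.

Let ell2_limZ k (x : ell2) : k * limn (series (fun i => x i ^+ 2)) =
  limn (series (k *: (fun i => x i ^+ 2 : R))).
Proof. by rewrite lim_seriesZ//; exact: ell2_cvg. Qed.

Lemma ell2_sum_ge0 (x : ell2) : 0 <= limn (series (fun k => x k ^+ 2)).
Proof.
apply: limr_ge; first exact: ell2_cvg.
by near=> n; apply: sumr_ge0 => k _; exact: sqr_ge0.
Unshelve. all: by end_near. Qed.

Lemma sqr_ell2_norm (x : ell2) :
  ell2_norm x ^+ 2 = limn (series (fun k => x k ^+ 2)).
Proof. by rewrite sqr_sqrtr// ell2_sum_ge0. Qed.

Lemma ell2_norm_eq0 x : ell2_norm x = 0 -> x = 0.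
Proof.
move=> x0; apply/val_inj/funext => k /=.
apply/eqP; rewrite -[_ == _]sqrf_eq0 eq_le sqr_ge0 andbT.
have nd : nondecreasing_seq (series (fun k => x k ^+ 2)).
  by apply: nondecreasing_series => n _ _; exact: sqr_ge0.
have := nondecreasing_cvgn_le nd (@ell2_cvg x) k.+1.
rewrite -sqr_ell2_norm x0 expr0n/=; apply: le_trans.
rewrite /series/= big_nat_recr//= lerDr.
by apply: sumr_ge0 => i _; exact: sqr_ge0.
Qed.

Lemma ell2_normZ a x : ell2_norm (a *: x) = `|a| * ell2_norm x.
Proof.
rewrite /ell2_norm -sqrtr_sqr -sqrtrM ?sqr_ge0//; congr Num.sqrt.
rewrite ell2_limZ.
by congr (limn (series _)); apply/funext => k; exact: exprMn.
Qed.

Lemma ell2_normD x y : ell2_norm (x + y) <= ell2_norm x + ell2_norm y.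
Proof.
have [x0|x0] := eqVneq (ell2_norm x) 0.
  by rewrite x0 (ell2_norm_eq0 x0) !add0r.
have [y0|y0] := eqVneq (ell2_norm y) 0.
  by rewrite y0 (ell2_norm_eq0 y0) !addr0.
set a := ell2_norm x in x0 *; set b := ell2_norm y in y0 *.
have a0 : 0 < a by rewrite lt_def x0 sqrtr_ge0.
have b0 : 0 < b by rewrite lt_def y0 sqrtr_ge0.
rewrite -ler_sqr ?nnegrE ?sqrtr_ge0//; last by rewrite addr_ge0// ltW.
rewrite sqr_ell2_norm.
have -> : (a + b) ^+ 2 = (1 + b / a) * a ^+ 2 + (1 + a / b) * b ^+ 2.
  by field; rewrite x0 y0.
rewrite !sqr_ell2_norm !ell2_limZ.
rewrite -lim_seriesD; [|apply: is_cvg_seriesZ; exact: ell2_cvg..].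
apply: lim_series_le; first exact: ell2_cvg.
  by apply: is_cvg_seriesD; apply: is_cvg_seriesZ; exact: ell2_cvg.
move=> k; rewrite -subr_ge0.
rewrite [leRHS](_ : _ = (b * x k - a * y k) ^+ 2 / (a * b)).
  by rewrite divr_ge0 ?sqr_ge0// ltW// mulr_gt0.
rewrite (_ : (x + y) k = x k + y k)// !fctE /GRing.scale/=.
by field; rewrite x0 y0.
Qed.

HB.instance Definition _ := Lmodule_isNormed.Build R ell2
  ell2_normD ell2_normZ ell2_norm_eq0.

End Ell2.

(* V is {poly rat} and c00 is {poly R}: a polynomial is the finitely supported
   sequence of its coefficients, and e_n is 'X^n.  Used as a type, the set
   pseudonorms R is the subtype with the topology induced by R^V, so closures
   of sets of type set (pseudonorms R) are taken in the space of pseudonorms. *)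
Definition pseudonorms (R : realType) : set {ptws {poly rat} -> R} :=
  [set mu | [/\ forall v, 0 <= mu v,
                forall q v, mu (q *: v) = ratr `|q| * mu v &
                forall v w, mu (v + w) <= mu v + mu w]].

Arguments pseudonorms : clear implicits.

Section Extension.
Context (R : realType) (mu : pseudonorms R).

Let f : {poly rat} -> R := set_val mu.
Local Notation emb := (map_poly (ratr : rat -> R)).

Let fP : pseudonorms R f. Proof. exact: set_valP. Qed.

Let f_ge0 v : 0 <= f v.
Proof. by have [+ _ _] := fP; exact. Qed.

Let fZ q v : f (q *: v) = `|ratr q| * f v.
Proof. by have [_ -> _] := fP; rewrite ratr_norm. Qed.

Let fD v w : f (v + w) <= f v + f w.
Proof. by have [_ _ +] := fP; exact. Qed.

Let f0 : f 0 = 0.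
Proof. by rewrite -(scale0r (0 : {poly rat})) fZ rmorph0 normr0 mul0r. Qed.

Definition weighted_l1 (x : {poly R}) : R :=
  \sum_(i < size x) `|x`_i| * f 'X^i.

Lemma weighted_l1E n (x : {poly R}) : (size x <= n)%N ->
  weighted_l1 x = \sum_(i < n) `|x`_i| * f 'X^i.
Proof.
move=> xn; rewrite /weighted_l1 (big_ord_widen n (fun i => `|x`_i| * f 'X^i))//.
rewrite big_mkcond/=; apply: eq_bigr => i _; case: ltnP => // xi.
by rewrite nth_default// normr0 mul0r.
Qed.

Lemma weighted_l1_ge0 x : 0 <= weighted_l1 x.
Proof. by apply: sumr_ge0 => i _; rewrite mulr_ge0. Qed.

Lemma weighted_l1D x y :
  weighted_l1 (x + y) <= weighted_l1 x + weighted_l1 y.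
Proof.
pose n := maxn (size x) (size y).
rewrite !(@weighted_l1E n) ?leq_maxl ?leq_maxr ?size_polyD//.
rewrite -big_split/=; apply: ler_sum => i _.
by rewrite -mulrDl coefD ler_wpM2r// ler_normD.
Qed.

Lemma weighted_l1Z a x : weighted_l1 (a *: x) = `|a| * weighted_l1 x.
Proof.
rewrite !(@weighted_l1E (size x)) ?size_scale_leq// mulr_sumr.
by apply: eq_bigr => i _; rewrite coefZ normrM mulrA.
Qed.

Lemma weighted_l1_ub (p : {poly R} -> R) : p 0 = 0 ->
  (forall a x, p (a *: x) = `|a| * p x) ->
  (forall x y, p (x + y) <= p x + p y) ->
  (forall i, p 'X^i = f 'X^i) -> forall x, p x <= weighted_l1 x.
Proof.
move=> p0 pZ pD pX x; rewrite -[x in leLHS]coefK poly_def /weighted_l1.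
elim/big_ind2 : _ => [|y a z b ya zb|i _]; first by rewrite p0.
  by rewrite (le_trans (pD _ _))// lerD.
by rewrite pZ pX.
Qed.

Lemma pseudonorm_le_weighted_l1 v : f v <= weighted_l1 (emb v).
Proof.
rewrite -[v in leLHS]coefK poly_def /weighted_l1 size_map_poly.
elim/big_ind2 : _ => [|y a z b ya zb|i _]; first by rewrite f0.
  by rewrite (le_trans (fD _ _))// lerD.
by rewrite fZ coef_map.
Qed.

(* The value at x of the only pseudonorm on c00 which restricts to mu on V; see
   extension_ratr and extension_unique. *)
Definition extension_fun (x : {poly R}) : R :=
  inf [set f v + weighted_l1 (x - emb v) | v in setT].

Let has_inf_ext x : has_inf [set f v + weighted_l1 (x - emb v) | v in setT].
Proof.
split; first by exists (f 0 + weighted_l1 (x - emb 0)), 0.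
by exists 0 => _ [v _ <-]; rewrite addr_ge0// weighted_l1_ge0.
Qed.

Let ext_le x v : extension_fun x <= f v + weighted_l1 (x - emb v).
Proof. by apply: ge_inf; [exact: (has_inf_ext x).2|exists v]. Qed.

Let ext_adh x e : 0 < e ->
  exists v, f v + weighted_l1 (x - emb v) < extension_fun x + e.
Proof.
move=> e0; have [_ [v _ <-] h] := inf_adherent e0 (has_inf_ext x).
by exists v.
Qed.

Lemma extension_ge0 x : 0 <= extension_fun x.
Proof.
apply: lb_le_inf; first exact: (has_inf_ext x).1.
by move=> _ [v _ <-]; rewrite addr_ge0// weighted_l1_ge0.
Qed.

Lemma extension_ratr v : extension_fun (emb v) = f v.
Proof.
apply/eqP; rewrite eq_le; apply/andP; split.
  rewrite (le_trans (ext_le _ v))// subrr /weighted_l1 size_poly0 big_ord0.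
  by rewrite addr0.
apply: lb_le_inf; first exact: (has_inf_ext _).1.
move=> _ [w _ <-]; rewrite -rmorphB.
rewrite (le_trans _ (lerD (lexx _) (pseudonorm_le_weighted_l1 _)))//.
by rewrite (le_trans _ (fD _ _))// addrC subrK.
Qed.

Lemma extensionD x y :
  extension_fun (x + y) <= extension_fun x + extension_fun y.
Proof.
apply/ler_addgt0Pr => e e0.
have e2 : 0 < e / 2 by rewrite divr_gt0.
have [v hv] := ext_adh x e2; have [w hw] := ext_adh y e2.
rewrite [in leRHS](splitr e) addrACA (le_trans _ (ltW (ltrD hv hw)))//.
rewrite (le_trans (ext_le _ (v + w)))// addrACA lerD// rmorphD/= opprD addrACA.
exact: weighted_l1D.
Qed.

Let extensionZ_le a x : extension_fun (a *: x) <= `|a| * extension_fun x.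
Proof.
apply/ler_addgt0Pr => e e0.
have e2 : 0 < e / 2 by rewrite divr_gt0.
have a1 : 0 < `|a| + 1 by rewrite ltr_pwDr.
have [v hv] := ext_adh x (divr_gt0 e2 a1).
set K := f v + weighted_l1 (emb v).
have K0 : 0 <= K by rewrite addr_ge0// weighted_l1_ge0.
have K1 : 0 < K + 1 by rewrite ltr_pwDr.
have eK : 0 < e / 2 / (K + 1) by rewrite divr_gt0.
have [b hb] : exists b : rat, `|a - ratr b| < e / 2 / (K + 1).
  have [b] : exists b, ratr b \in `]a - e / 2 / (K + 1), a + e / 2 / (K + 1)[.
    by apply: rat_in_itvoo; rewrite ltrD2l gtrN.
  by rewrite in_itv/= -ltr_distl => ab; exists b; rewrite distrC.
rewrite (le_trans (ext_le _ (b *: v)))// fZ.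
have -> : a *: x - emb (b *: v) =
    a *: (x - emb v) + (a - ratr b) *: emb v.
  by rewrite map_polyZ/= scalerBr scalerBl addrA subrK.
rewrite (le_trans (lerD (lexx _) (weighted_l1D _ _)))// !weighted_l1Z.
have hab : `|ratr b| <= `|a| + `|a - ratr b|.
  by rewrite -lerBlDl (le_trans (lerB_dist _ _))// distrC.
rewrite (@le_trans _ _ (`|a| * (f v + weighted_l1 (x - emb v)) +
                        `|a - ratr b| * K))//.
  rewrite [leRHS](_ : _ = (`|a| + `|a - ratr b|) * f v +
    (`|a| * weighted_l1 (x - emb v) + `|a - ratr b| * weighted_l1 (emb v))).
    by rewrite lerD2r ler_wpM2r.
  by rewrite /K; ring.
rewrite [in leRHS](splitr e) addrA lerD//.
  rewrite (le_trans (ler_wpM2l (normr_ge0 _) (ltW hv)))// mulrDr lerD2l.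
  rewrite mulrA ler_pdivrMr// [leLHS]mulrC.
  by rewrite ler_wpM2l ?(ltW e2)// lerDl.
rewrite (le_trans (ler_wpM2r K0 (ltW hb)))//.
by rewrite mulrAC ler_pdivrMr// ler_wpM2l ?(ltW e2)// lerDl.
Qed.

Lemma extensionZ a x : extension_fun (a *: x) = `|a| * extension_fun x.
Proof.
apply/eqP; rewrite eq_le extensionZ_le/=.
have [->|a0] := eqVneq a 0; first by rewrite normr0 mul0r extension_ge0.
rewrite -ler_pdivlMl ?normr_gt0// -normfV.
by rewrite (le_trans _ (extensionZ_le _ _))// scalerA mulVf// scale1r.
Qed.

Definition extension : seminorm {poly R} :=
  Seminorm extension_ge0 extensionZ extensionD.

Lemma weighted_l1_dense x e : 0 < e -> exists v, weighted_l1 (x - emb v) < e.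
Proof.
move=> e0; pose K := \sum_(i < size x) f 'X^i.
have K0 : 0 <= K by exact: sumr_ge0.
have K1 : 0 < K + 1 by rewrite ltr_pwDr.
have d0 : 0 < e / (K + 1) by rewrite divr_gt0.
have /choice[q hq] : forall i, exists b : rat, `|x`_i - ratr b| < e / (K + 1).
  move=> i.
  have [b] : exists b, ratr b \in `]x`_i - e / (K + 1), x`_i + e / (K + 1)[.
    by apply: rat_in_itvoo; rewrite ltrD2l gtrN.
  by rewrite in_itv/= -ltr_distl => ab; exists b; rewrite distrC.
exists (\poly_(i < size x) q i).
rewrite (@weighted_l1E (size x)); last first.
  rewrite (leq_trans (size_polyD _ _))// geq_max leqnn size_polyN.
  by rewrite size_map_poly size_poly.
rewrite (@le_lt_trans _ _ (e / (K + 1) * K))//.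
  rewrite /K mulr_sumr; apply: ler_sum => i _; apply: ler_wpM2r => //.
  by rewrite coefB coef_map coef_poly ltn_ord ltW.
by rewrite mulrAC ltr_pdivrMr// ltr_pM2l// ltrDl.
Qed.

Lemma extension_unique (p : seminorm {poly R}) :
  (forall v, p (emb v) = f v) -> p =1 extension.
Proof.
move=> pf x.
have embX i : 'X^i = emb 'X^i by rewrite map_polyXn.
have pub y : p y <= weighted_l1 y.
  apply: weighted_l1_ub; [exact: seminorm0|exact: seminormZ|exact: seminormD|].
  by move=> i; rewrite embX pf.
have eub y : extension y <= weighted_l1 y.
  apply: weighted_l1_ub; [exact: seminorm0|exact: seminormZ|exact: seminormD|].
  by move=> i; rewrite embX; exact: extension_ratr.
apply/eqP; rewrite -subr_eq0 -normr_le0; apply/ler_addgt0Pr => e e0.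
have e2 : 0 < e / 2 by rewrite divr_gt0.
have [v hv] := weighted_l1_dense x e2.
rewrite add0r.
have -> : p x - extension x =
    (p x - p (emb v)) + (extension (emb v) - extension x).
  by rewrite pf /= extension_ratr addrA subrK.
rewrite (le_trans (ler_normD _ _))// [leRHS]splitr lerD//.
  by rewrite (le_trans (seminorm_dist _ _ _))// (le_trans (pub _))// ltW.
rewrite (le_trans (seminorm_dist _ _ _))// seminorm_distC.
by rewrite (le_trans (eub _))// ltW.
Qed.

End Extension.

Notation Xspace mu := (completion (extension mu)).

Definition P_infty (R : realType) : set (pseudonorms R) :=
  [set mu | infinite_dimensional (Xspace mu)].

Definition B_class (R : realType) : set (pseudonorms R) :=
  [set mu | P_infty mu /\ forall x, extension mu x = 0 -> x = 0].
Arguments P_infty : clear implicits.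
Arguments B_class : clear implicits.

(* Main.v *)
Require Import Defs.
From HB Require Import structures.
From mathcomp Require Import all_boot all_order all_algebra.
From mathcomp Require Import ring lra zify.
From mathcomp Require Import all_classical all_reals all_analysis.

Set Implicit Arguments.
Unset Strict Implicit.
Unset Printing Implicit Defensive.

Import Order.TTheory GRing.Theory Num.Theory.
Import numFieldNormedType.Exports.

Local Open Scope classical_set_scope.
Local Open Scope ring_scope.


(* The heart of the matter is Dvoretzky's theorem: X contains almost isometric
   copies of the Euclidean spaces.  Iterated limits along an ultrafilter give a
   spreading norm finitely represented in X; passing to blocks makes it
   suppression unconditional, then unconditional.  For the dilations T_j, which
   repeat each coordinate j times, almost invariant weights on the multiplicative
   semigroup of k and k+1 yield common approximate eigenvectors of T_k and T_(k+1)
   (Krivine); the corresponding blocks span a norm N which is invariant under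
   permutations of n coordinates up to a factor 1 + 1/k.
   Now take a net x_1, ..., x_n of the sphere with the least possible number of
   points.  By Hall's theorem every reflection moves it to a small perturbation
   of a permutation of itself, hence the norm a |-> N (<a, x_1>, ..., <a, x_n>) is
   almost constant on the sphere.

   If X_mu is isometric to l_2, then finitely many values of mu are determined, up
   to a small error, by finitely many vectors of a Euclidean space.  Copy the
   images of e_0, ..., e_(L-1) in X by Dvoretzky's theorem, perturb them and
   continue them to a linearly independent sequence (y_i) with dense range.  The
   pseudonorm nu x = |\sum_i x_i y_i| is then a norm on c00, close to mu, and X_nu is
   isometric to X. *)

(** * Spreading seminorms *)

(** Krivine's theorem enters only through symmetry: N is never identified with an l_p norm. The
    exponent alpha is the growth rate of N (1, ..., 1). Both k and k+1 are wanted because the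
    numbers ((k+1)^i k^(J-i))^alpha form a geometric progression of ratio (1+1/k)^alpha. Entries
    rounded to it can each be exchanged for copies of one number, and the total number of copies
    ignores their order. For alpha = 0 the progression is constant, but then k equal entries weigh
    as much as one, and N is the maximum norm on lists of at most k entries. Approximate invariance
    becomes exact by passing to an ultralimit of blocks. This is why norms are functions of finite
    lists: being finitely represented in X ([modeled]) survives blocks, rescaling and pointwise
    limits, and no intermediate Banach space has to be built. In dimension at least 2 no nonempty
    finite subset of the sphere is mapped to itself by every reflection; the least cardinality of
    the net, with Hall's theorem, takes the place of an invariant measure on the sphere. *)

Section Lists.
Context (R : realType).
Implicit Types (s t u : seq R) (a c : R).

Definition ladd s t := [seq p.1 + p.2 | p <- zip s t].
Definition lscale c s := [seq c * x | x <- s].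
(** The coefficients of \sum_i s_i b_i, where b_0, b_1, ... are consecutive disjoint copies of the
    block u. *)
Definition kron s u := flatten [seq lscale a u | a <- s].

Lemma size_ladd s t : size (ladd s t) = minn (size s) (size t).
Proof. by rewrite size_map size_zip. Qed.

Lemma ladd_cat s1 s2 t1 t2 : size s1 = size t1 ->
  ladd (s1 ++ s2) (t1 ++ t2) = ladd s1 t1 ++ ladd s2 t2.
Proof. by move=> e; rewrite /ladd zip_cat// map_cat. Qed.

Lemma ladd_cons a c s t : ladd (a :: s) (c :: t) = (a + c) :: ladd s t.
Proof. by []. Qed.

Lemma ladd_mkseq n (f g : nat -> R) :
  ladd (mkseq f n) (mkseq g n) = mkseq (fun i => f i + g i) n.
Proof. by rewrite /ladd zip_map -map_comp. Qed.

Lemma lscale_mkseq n c (f : nat -> R) :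
  lscale c (mkseq f n) = mkseq (fun i => c * f i) n.
Proof. by rewrite /lscale -map_comp. Qed.

Lemma ladd_nseq0 n s : size s = n -> ladd s (nseq n 0) = s.
Proof.
move=> <-; elim: s => //= a s IH.
by rewrite ladd_cons addr0 IH.
Qed.

Lemma laddC s t : ladd s t = ladd t s.
Proof.
elim: s t => [|a s IH] [|b t]//=.
by rewrite !ladd_cons addrC IH.
Qed.

Lemma lscale1 s : lscale 1 s = s.
Proof. by rewrite /lscale -[RHS]map_id; apply: eq_map => x /=; rewrite mul1r. Qed.

Lemma lscaleA a c s : lscale a (lscale c s) = lscale (a * c) s.
Proof. by rewrite /lscale -map_comp; apply: eq_map => x /=; rewrite mulrA. Qed.

Lemma lscale0 s : lscale 0 s = nseq (size s) 0.
Proof. by elim: s => //= a s <-; rewrite mul0r. Qed.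

Lemma lscale_nseq0 c n : lscale c (nseq n 0) = nseq n 0.
Proof. by rewrite /lscale map_nseq mulr0. Qed.

Lemma lscale_cat c s t : lscale c (s ++ t) = lscale c s ++ lscale c t.
Proof. exact: map_cat. Qed.

Lemma lscale_ladd c s t : lscale c (ladd s t) = ladd (lscale c s) (lscale c t).
Proof.
elim: s t => [|a s IH] [|b t]//.
by rewrite /lscale/= -!/(lscale _ _) !ladd_cons -IH mulrDr.
Qed.

Lemma size_lscale c s : size (lscale c s) = size s.
Proof. exact: size_map. Qed.

Lemma kron_cat s t u : kron (s ++ t) u = kron s u ++ kron t u.
Proof. by rewrite /kron map_cat flatten_cat. Qed.

Lemma kron_cons a s u : kron (a :: s) u = lscale a u ++ kron s u.
Proof. by []. Qed.

Lemma size_kron s u : size (kron s u) = (size s * size u)%N.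
Proof.
by elim: s => //= a s IH; rewrite kron_cons size_cat size_lscale IH mulSn.
Qed.

Lemma kron_ladd s t u : size s = size t ->
  kron (ladd s t) u = ladd (kron s u) (kron t u).
Proof.
elim: s t => [|a s IH] [|b t]//= [st].
rewrite ladd_cons !kron_cons ladd_cat ?size_lscale// IH//.
congr (_ ++ _); rewrite /ladd /lscale zip_map -map_comp.
by apply: eq_map => x /=; rewrite mulrDl.
Qed.

Lemma kron_lscale c s u : kron (lscale c s) u = lscale c (kron s u).
Proof.
by elim: s => //= a s IH; rewrite !kron_cons lscale_cat lscaleA IH.
Qed.

Lemma nth_kron s u i : nth 0 (kron s u) i =
  nth 0 s (i %/ size u) * nth 0 u (i %% size u).
Proof.
elim: s i => [|a s IH] i; first by rewrite !nth_nil mul0r.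
case: (posnP (size u)) => [u0|u0].
  rewrite nth_default ?size_kron ?u0 ?muln0//.
  by rewrite [nth 0 u _]nth_default ?u0// mulr0.
rewrite kron_cons nth_cat size_lscale; case: ltnP => iu.
  by rewrite divn_small// modn_small// (nth_map 0).
rewrite IH -{3 4}(subnK iu) modnDr divnDr// divnn u0 addn1.
by [].
Qed.

End Lists.

Section Spreading.
Context (R : realType).
Implicit Types (s t u : seq R) (a c : R) (N : seq R -> R).

(* A spreading seminorm on c00: N s is the norm of \sum_i s`_i u_(k i), whatever
   the increasing sequence k. *)
Record spreading N : Prop := Spreading {
  spreadingD : forall s t, size s = size t -> N (ladd s t) <= N s + N t;
  spreadingZ : forall c s, N (lscale c s) = `|c| * N s;
  spreading0 : forall s t, N (s ++ 0 :: t) = N (s ++ t)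
}.

Section Theory.
Context N (spN : spreading N).

Lemma spreading_nseq0 n s t : N (s ++ nseq n 0 ++ t) = N (s ++ t).
Proof. by elim: n => //= n IH; rewrite spreading0. Qed.

Lemma spreading_cat0 n s : N (s ++ nseq n 0) = N s.
Proof. by rewrite -[nseq n 0]cats0 spreading_nseq0 cats0. Qed.

Lemma spreading_nil : N [::] = 0.
Proof. by have := spreadingZ spN 0 [::]; rewrite normr0 mul0r. Qed.

Lemma spreading_ge0 s : 0 <= N s.
Proof.
have := spreadingD spN (s := s) (t := lscale (-1) s).
rewrite size_lscale => /(_ erefl).
have -> : ladd s (lscale (-1) s) = nseq (size s) 0.
  by elim: s => //= a s <-; rewrite ladd_cons mulN1r subrr.
rewrite -[nseq _ _]cat0s spreading_cat0 spreading_nil spreadingZ//.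
by rewrite normrN1 mul1r -mulr2n pmulrn_lge0.
Qed.

Lemma spreading_pad s i n m :
  N (nseq i 0 ++ s ++ nseq n 0) = N s /\ N (s ++ nseq m 0) = N s.
Proof.
by rewrite -[nseq i 0 ++ _]cat0s spreading_nseq0 /= !spreading_cat0.
Qed.

(** The zeros around the difference of the two middle blocks are invisible to N, so this is the
    triangle inequality. All perturbation arguments below go through it. *)
Lemma spreading_swap s t x y : size x = size y ->
  N (s ++ x ++ t) <= N (s ++ y ++ t) + N (ladd x (lscale (-1) y)).
Proof.
move=> xy.
pose d := ladd x (lscale (-1) y).
have sd : size d = size y by rewrite size_ladd size_lscale xy minnn.
have -> : s ++ x ++ t =
    ladd (s ++ y ++ t) (nseq (size s) 0 ++ d ++ nseq (size t) 0).
  rewrite !ladd_cat ?size_nseq//.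
  rewrite !ladd_nseq0//; congr (_ ++ (_ ++ _)).
  rewrite /d; elim: x y xy {d sd} => [|a x IH] [|b y]//= [xy].
  by rewrite /= !ladd_cons -IH// mulN1r addrC subrK.
rewrite (le_trans (spreadingD spN _))// ?size_cat ?size_nseq ?sd//.
by rewrite (spreading_pad _ _ _ 0).1.
Qed.

Lemma spreading_distC s t : N (ladd s (lscale (-1) t)) = N (ladd t (lscale (-1) s)).
Proof.
transitivity (N (lscale (-1) (ladd s (lscale (-1) t)))).
  by rewrite spreadingZ// normrN1 mul1r.
by rewrite lscale_ladd lscaleA mulrNN mulr1 lscale1 laddC.
Qed.

Lemma spreading_sum n (I : Type) (r : seq I) (f : I -> nat -> R) :
  N (mkseq (fun i => \sum_(j <- r) f j i) n) <= \sum_(j <- r) N (mkseq (f j) n).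
Proof.
elim: r => [|j r IH].
  rewrite big_nil [mkseq _ _](_ : _ = lscale 0 (nseq n 0)).
    by rewrite spreadingZ// normr0 mul0r.
  rewrite lscale_nseq0; apply: (@eq_from_nth _ 0).
    by rewrite size_mkseq size_nseq.
  by move=> i; rewrite size_mkseq => ni; rewrite nth_mkseq// nth_nseq ni big_nil.
rewrite big_cons (eq_mkseq (g := fun i => f j i + \sum_(j <- r) f j i)).
  by rewrite -ladd_mkseq (le_trans (spreadingD spN _)) ?size_mkseq// lerD2l.
by move=> i; rewrite big_cons.
Qed.

(** Once N [:: 1] = 1 the bound is the same for all N: it makes the ultralimits exist, and N (1,
    ..., 1) grow at most linearly. *)
Lemma spreading_le s : N s <= N [:: 1] * \sum_(a <- s) `|a|.
Proof.
elim: s => [|a s IH]; first by rewrite spreading_nil big_nil mulr0.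
have {1}-> : a :: s = ladd (a :: nseq (size s) 0) (0 :: s).
  by rewrite ladd_cons addr0 laddC ladd_nseq0.
rewrite (le_trans (spreadingD spN _))/= ?size_nseq//.
rewrite -[0 :: s]cat0s spreading0//= -[a :: _]cat1s spreading_cat0.
rewrite (_ : [:: a] = lscale a [:: 1]) ?spreadingZ//= ?mulr1//.
by rewrite big_cons mulrDr mulrC lerD2l.
Qed.

Lemma spreading_kron u : spreading (fun s => N (kron s u)).
Proof.
split.
- by move=> s t st; rewrite kron_ladd// spreadingD// !size_kron st.
- by move=> c s; rewrite kron_lscale spreadingZ.
- by move=> s t; rewrite !kron_cat kron_cons lscale0 spreading_nseq0.
Qed.

Lemma spreading_scale k : 0 <= k -> spreading (fun s => N s / k).
Proof.
move=> k0; split.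
- by move=> s t st; rewrite -mulrDl ler_wpM2r ?invr_ge0// spreadingD.
- by move=> c s; rewrite spreadingZ// mulrA.
- by move=> s t; rewrite spreading0.
Qed.

End Theory.

Section Modeled.
Context (X : normedModType R).

(** Finite representability of N in X. The vectors may depend on S and e, and nothing is asked about
    their independence. *)
Definition modeled N := forall (S : seq (seq R)) e, 0 < e ->
  exists x : nat -> X, forall s, s \in S ->
    `| `|\sum_(i < size s) s`_i *: x i| - N s | < e.

Lemma modeled_kron N u : modeled N -> modeled (fun s => N (kron s u)).
Proof.
move=> mN S e e0.
have [x hx] := mN [seq kron s u | s <- S] e e0.
exists (fun i => \sum_(j < size u) u`_j *: x (i * size u + j)%N) => s sS.
have := hx _ (map_f (fun s => kron s u) sS); congr (`| `|_| - _| < e).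
rewrite size_kron.
elim: (size s) => [|n IH]; first by rewrite !big_ord0.
rewrite big_ord_recr/= -IH mulSn addnC big_split_ord/=; congr (_ + _).
rewrite scaler_sumr; apply: eq_bigr => i _.
rewrite nth_kron scalerA; congr (_ *: _); congr (_ * _).
  by rewrite divnMDl ?divn_small ?addn0// (leq_ltn_trans _ (ltn_ord i)).
by rewrite modnMDl modn_small.
Qed.

Lemma modeled_scale N k : 0 < k -> modeled N -> modeled (fun s => N s / k).
Proof.
move=> k0 mN S e e0.
have [x hx] := mN S (e * k) (mulr_gt0 e0 k0).
exists (fun i => k^-1 *: x i) => s sS.
have -> : \sum_(i < size s) s`_i *: (k^-1 *: x i) =
    k^-1 *: \sum_(i < size s) s`_i *: x i.
  by rewrite scaler_sumr; apply: eq_bigr => i _; rewrite !scalerA mulrC.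
rewrite normrZ gtr0_norm ?invr_gt0// mulrC -mulrBl normrM.
by rewrite (gtr0_norm (x := k^-1)) ?invr_gt0// ltr_pdivrMr// hx.
Qed.

End Modeled.

End Spreading.

(** * A spreading model of X *)

Lemma filter_seq (I : eqType) (T : Type) (F : set_system T) (s : seq I)
    (P : I -> T -> Prop) : Filter F ->
  (forall i, \forall x \near F, P i x) ->
  \forall x \near F, forall i, i \in s -> P i x.
Proof.
move=> FF FP; elim: s => [|i s IH]; first exact: nearW.
apply: filterS2 (FP i) IH => x h1 h2 j; rewrite inE => /predU1P[->|]//; exact: h2.
Qed.

Section Ultralimits.
Context (R : realType).

Lemma ultra_cvg (T : Type) (U : set_system T) (f : T -> R) (M : R) :
  UltraFilter U -> (\forall x \near U, `|f x| <= M) -> cvg (f @ U).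
Proof.
move=> UU fM.
have cpt : compact `[- M, M]%classic by exact: segment_compact.
have [|p [_ clp]] := cpt (f @ U) _.
  by apply: filterS fM => x; rewrite /= in_itv/= ler_norml.
apply/cvg_ex; exists p => A pA.
have [//|UnA] := in_ultra_setVsetC (f @^-1` A) UU.
by have [x []] := clp (~` A) A UnA pA.
Qed.

Lemma modeled_lim (X : normedModType R) (T : Type) (U : set_system T)
    (N_ : T -> seq R -> R) (N : seq R -> R) : ProperFilter U ->
  (forall t, modeled X (N_ t)) -> (forall s, N_ t s @[t --> U] --> N s) ->
  modeled X N.
Proof.
move=> PU mN cN S e e0; have e2 : 0 < e / 2 by rewrite divr_gt0.
have nS : \forall t \near U, forall s, s \in S -> `|N_ t s - N s| < e / 2.
  apply: filter_seq => s; have /cvgrPdist_lt/(_ _ e2) := cN s.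
  by apply: filterS => t; rewrite distrC.
have [t ht] := filter_ex nS; have [x hx] := mN t S _ e2.
exists x => s sS; rewrite (splitr e) (le_lt_trans (ler_distD (N_ t s) _ _))//.
by rewrite ltrD ?hx ?ht.
Qed.

(** The normalisation bounds the [N_ m s] uniformly in m, so they converge along an ultrafilter
    finer than \oo. Inequalities that hold up to every e for large m become exact. *)
Lemma ultralimit (X : normedModType R) (N_ : nat -> seq R -> R) :
  (forall m, [/\ spreading (N_ m), modeled X (N_ m) & N_ m [:: 1] = 1]) ->
  exists N, [/\ spreading N, modeled X N, N [:: 1] = 1 &
    forall s t, (forall e, 0 < e -> \forall m \near \oo, N_ m s <= N_ m t + e) ->
      N s <= N t].
Proof.
move=> hN.
have spN m : spreading (N_ m) by have [] := hN m.
have mN m : modeled X (N_ m) by have [] := hN m.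
have N1 m : N_ m [:: 1] = 1 by have [] := hN m.
have [U [UU ooU]] := ultraFilterLemma eventually_filter.
pose N s := lim (N_ m s @[m --> U]).
have cN s : N_ m s @[m --> U] --> N s.
  apply: (@ultra_cvg _ _ _ (\sum_(a <- s) `|a|)).
  apply: nearW => m; rewrite ger0_norm ?spreading_ge0//.
  by rewrite (le_trans (spreading_le (spN m) s))// N1 mul1r.
have limE s l : N_ m s @[m --> U] --> l -> N s = l by move=> /cvg_lim; apply.
exists N; split.
- split.
  + move=> s t st; rewrite /N -limD; [|exact: cN..].
    apply: ler_lim; [exact: cN|apply: is_cvgD; exact: cN|].
    by apply: nearW => m; exact: spreadingD.
  + move=> c s; apply: limE; under eq_fun do rewrite spreadingZ//.
    by apply: cvgMr; exact: cN.
  + by move=> s t; apply: limE; under eq_fun do rewrite spreading0//; exact: cN.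
- exact: modeled_lim mN cN.
- by apply: limE; under eq_fun do rewrite N1; exact: cvg_cst.
- move=> s t h; apply/ler_addgt0Pr => e e0.
  have ct : (N_ m t + e) @[m --> U] --> N t + e.
    by apply: cvgD; [exact: cN|exact: cvg_cst].
  apply: ler_cvg_to (cN s) ct _.
  by apply: ooU; exact: h.
Qed.

End Ultralimits.

Section IteratedLimits.
Context (R : realType) (X : completeNormedModType R).

(* If finitely many balls of radius 1/2 covered the unit ball, the centers would
   span X: iterating x |-> 2 (x - c) writes x as a series in the centers. *)
Lemma unit_ball_not_covered : infinite_dimensional X ->
  forall c : seq X, exists x : X, `|x| <= 1 /\
    forall y, y \in c -> 2^-1 <= `|y - x|.
Proof.
move=> Xinf c; apply: contrapT => nex; apply: Xinf.
have cov (x : X) : `|x| <= 1 -> exists i : 'I_(size c), `|c`_i - x| <= 2^-1.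
  move=> x1; apply: contrapT => ni; apply: nex; exists x; split => // y yc.
  have yi : (index y c < size c)%N by rewrite index_mem.
  rewrite leNgt; apply/negP => yx; apply: ni; exists (Ordinal yi) => /=.
  by rewrite nth_index// ltW.
exists (size c), (fun i => c`_i).
have span1 (x : X) : `|x| <= 1 -> exists a, x = \sum_(i < size c) a i *: c`_i.
  move=> x1.
  have /choice[f hf] : forall z : X, exists i : 'I_(size c),
      `|z| <= 1 -> `|c`_i - z| <= 2^-1.
    move=> z; case: (pselect (`|z| <= 1)) => [/cov[i hi]|nz]; first by exists i.
    by have [i _] := cov _ x1; exists i.
  (* [r n] is the remainder after n terms, multiplied by 2^n so as to stay in the unit ball. *)
  pose r := fix r n := if n is m.+1 then 2 *: (r m - c`_(f (r m))) else x.
  have r1 n : `|r n| <= 1.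
    elim: n => //= n IH; rewrite normrZ distrC ger0_norm// mulrC.
    by rewrite -ler_pdivlMr// div1r hf.
  pose a i n : R := \sum_(k < n) (f (r k) == i)%:R * 2^-1 ^+ k.
  have xE n : x = \sum_(i < size c) a i n *: c`_i + 2^-1 ^+ n *: r n.
    elim: n => [|n IH].
      rewrite big1 ?add0r ?expr0 ?scale1r// => i _.
      by rewrite /a big_ord0 scale0r.
    rewrite [LHS]IH /= scalerA exprSr -mulrA mulVf// mulr1 scalerBr.
    rewrite addrCA [RHS]addrC; congr (_ + _).
    apply/eqP; rewrite eq_sym subr_eq; apply/eqP.
    under eq_bigr do rewrite /a big_ord_recr/= scalerDl.
    rewrite big_split/=; congr (_ + _).
    rewrite (bigD1 (f (r n)))//= eqxx mul1r big1 ?addr0// => i ni.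
    by rewrite eq_sym (negbTE ni) mul0r scale0r.
  have ca i : cvgn (a i).
    have -> : a i = series (fun k => (f (r k) == i)%:R * 2^-1 ^+ k).
      by apply/funext => n; rewrite /a /series/= big_mkord.
    apply: (@series_le_cvg _ _ (fun k => 2^-1 ^+ k)).
    - by move=> k; rewrite mulr_ge0// exprn_ge0.
    - by move=> k; rewrite exprn_ge0.
    - move=> k; rewrite ler_piMl ?exprn_ge0//; by case: eqP.
    - have := @is_cvg_geometric_series R 1 2^-1.
      rewrite /geometric ger0_norm//; under eq_fun do rewrite mul1r; apply.
      by rewrite invf_lt1// ltr1n.
  exists (fun i => limn (a i)).
  have c1 : (\sum_(i < size c) a i n *: c`_i) @[n --> \oo] -->
      \sum_(i < size c) limn (a i) *: c`_i.
    apply: cvg_big => [|i _]; first exact: add_continuous.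
    by apply: cvgZr_tmp; exact: ca.
  have c2 : (2^-1 ^+ n *: r n) @[n --> \oo] --> (0 : X).
    apply: norm_cvg0; apply: (@squeeze_cvgr _ _ _ _ (cst 0) (fun n => 2^-1 ^+ n)).
    - apply: nearW => n; rewrite normr_ge0 normrZ ger0_norm ?exprn_ge0//=.
      by rewrite ler_piMr ?exprn_ge0.
    - exact: cvg_cst.
    - by apply: cvg_expr; rewrite ger0_norm// invf_lt1// ltr1n.
  have cx : (fun _ : nat => x) @ \oo --> \sum_(i < size c) limn (a i) *: c`_i.
    rewrite -[X in _ --> X]addr0.
    rewrite [fun=> x](_ : _ = fun n => \sum_(i < size c) a i n *: c`_i +
        2^-1 ^+ n *: r n); last by apply/funext => n; exact: xE.
    exact: cvgD c1 c2.
  by rewrite -(cvg_lim _ cx)// lim_cst.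
move=> x; have [->|x0] := eqVneq x 0.
  by exists (fun=> 0); rewrite big1// => i _; rewrite scale0r.
have [|a ha] := span1 (`|x|^-1 *: x).
  by rewrite normrZ normfV normr_id mulVf ?normr_eq0.
exists (fun i => `|x| * a i); rewrite -[LHS](scalerKV (a := `|x|)) ?normr_eq0// ha scaler_sumr.
by apply: eq_bigr => i _; rewrite scalerA.
Qed.

(** By the previous lemma the sets containing the unit ball minus finitely many open balls of radius
    1/2 form a proper filter. An ultrafilter finer than it plays the part of a separated sequence
    along which all bounded limits exist. *)
Lemma separated_ultrafilter : infinite_dimensional X ->
  exists U : set_system X, [/\ UltraFilter U,
    \forall x \near U, `|x| <= 1 & forall y, \forall x \near U, 2^-1 <= `|y - x|].
Proof.
move=> /unit_ball_not_covered hc.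
pose F : set_system X := [set A | exists c : seq X, forall x, `|x| <= 1 ->
  (forall y, y \in c -> 2^-1 <= `|y - x|) -> A x].
have PF : ProperFilter F.
  apply: Build_ProperFilter_ex.
    by move=> A [c cA]; have [x [x1 xc]] := hc c; exists x; exact: cA.
  split.
  - by exists [::].
  - move=> A B [c cA] [d dB]; exists (c ++ d) => x x1 xcd; split.
      by apply: cA => // y yc; apply: xcd; rewrite mem_cat yc.
    by apply: dB => // y yd; apply: xcd; rewrite mem_cat yd orbT.
  - by move=> A B AB [c cA]; exists c => x x1 xc; apply/AB/cA.
have [U [UU FU]] := ultraFilterLemma PF.
exists U; split => // [|y]; apply: FU; first by exists [::].
by exists [:: y] => x _; apply; rewrite inE.
Qed.

Section IteratedLimit.
Context (U : set_system X) (UU : UltraFilter U).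
Hypothesis U1 : \forall x \near U, `|x| <= 1.

(* The iterated limit of the norm of x + \sum_i s`_i y_i along U, in the last y_i
   first.  Zero entries play no role, so that itlim 0 is spreading without any
   appeal to Ramsey's theorem. *)
Fixpoint itlim (x : X) (s : seq R) : R :=
  if s is a :: t then lim (itlim (x + a *: y) t @[y --> U]) else `|x|.

Let itlim_bounds x s : 0 <= itlim x s <= `|x| + \sum_(a <- s) `|a| /\
  (if s is a :: t then
     itlim (x + a *: y) t @[y --> U] --> itlim x s else True).
Proof.
elim: s x => [|a s IH] x; first by rewrite big_nil addr0 /= lexx normr_ge0.
have h : \forall y \near U, 0 <= itlim (x + a *: y) s <= `|x| + \sum_(b <- a :: s) `|b|.
  apply: filterS U1 => y y1.
  have [/andP[-> /= h] _] := IH (x + a *: y).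
  rewrite (le_trans h)// big_cons addrA lerD2r (le_trans (ler_normD _ _))// lerD2l.
  by rewrite normrZ ler_piMr.
have cvx : cvg (itlim (x + a *: y) s @[y --> U]).
  apply: (@ultra_cvg _ _ _ _ (`|x| + \sum_(b <- a :: s) `|b|)).
  by apply: filterS h => y /andP[y0 yM]; rewrite ger0_norm.
split => //=; apply/andP; split.
  by apply: limr_ge => //; apply: filterS h => y /andP[].
by apply: limr_le => //; apply: filterS h => y /andP[].
Qed.

Lemma itlim_cvg x a s : itlim (x + a *: y) s @[y --> U] --> itlim x (a :: s).
Proof. by have [] := itlim_bounds x (a :: s). Qed.

(** The empty list counts as a leading zero, so that lists of different lengths can share their
    first vector in [itlim_approx]. *)
Lemma itlim_cvg' x s :
  itlim (x + head 0 s *: y) (behead s) @[y --> U] --> itlim x s.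
Proof.
case: s => [|a s]; last exact: itlim_cvg.
by under eq_fun do rewrite scale0r addr0; exact: cvg_cst.
Qed.

Let itlim_lim x a s l :
  itlim (x + a *: y) s @[y --> U] --> l -> itlim x (a :: s) = l.
Proof. by move=> /cvg_lim; apply. Qed.

Lemma itlim0 x s t : itlim x (s ++ 0 :: t) = itlim x (s ++ t).
Proof.
elim: s x => [|a s IH] x.
  apply: itlim_lim; under eq_fun do rewrite scale0r addr0; exact: cvg_cst.
by apply: itlim_lim; under eq_fun do rewrite IH; exact: itlim_cvg.
Qed.

Lemma itlimZ c x s : itlim (c *: x) (lscale c s) = `|c| * itlim x s.
Proof.
elim: s x => [|a s IH] x; first exact: normrZ.
apply: itlim_lim; under eq_fun do rewrite -scalerA -scalerDr IH.
by apply: cvgMr; exact: itlim_cvg.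
Qed.

Lemma itlimD x y s t : size s = size t ->
  itlim (x + y) (ladd s t) <= itlim x s + itlim y t.
Proof.
elim: s t x y => [|a s IH] [|b t]// x y; first by rewrite /= ler_normD.
move=> [st]; rewrite ladd_cons.
have ct : (itlim (x + a *: z) s + itlim (y + b *: z) t) @[z --> U] -->
    itlim x (a :: s) + itlim y (b :: t) by apply: cvgD; exact: itlim_cvg.
apply: ler_cvg_to (@itlim_cvg _ _ _) ct _; apply: nearW => z.
by rewrite scalerDl addrACA IH.
Qed.

Lemma itlim_spreading : spreading (itlim 0).
Proof.
split.
- by move=> s t st; rewrite -[0 in leLHS]addr0 itlimD.
- by move=> c s; rewrite -[0 in LHS](scaler0 _ c) itlimZ.
- exact: itlim0.
Qed.

(** The vectors are chosen one at a time: z 0 realises the outermost limit for all pairs of S at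
    once, and is then absorbed in their first components. This is what the base points are for. *)
Lemma itlim_approx n (S : seq (X * seq R)) e : 0 < e ->
  exists z : nat -> X, forall p, p \in S -> (size p.2 <= n)%N ->
    `| `|p.1 + \sum_(i < size p.2) p.2`_i *: z i| - itlim p.1 p.2| < e.
Proof.
elim: n S e => [|n IH] S e e0.
  exists (fun=> 0) => -[x [|//]] _ _; rewrite big_ord0 addr0/= subrr normr0.
  exact: e0.
have e2 : 0 < e / 2 by rewrite divr_gt0.
have /filter_ex[z0 hz0] : \forall y \near U, forall p, p \in S ->
    `|itlim (p.1 + head 0 p.2 *: y) (behead p.2) - itlim p.1 p.2| < e / 2.
  apply: filter_seq => p; have /cvgrPdist_lt/(_ _ e2) := @itlim_cvg' p.1 p.2.
  by apply: filterS => y; rewrite distrC.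
pose S' := [seq (p.1 + head 0 p.2 *: z0, behead p.2) | p <- S].
have [z hz] := IH S' _ e2.
exists (fun i => if i is j.+1 then z j else z0) => p pS pn.
have := hz _ (map_f _ pS); rewrite size_behead/= => /(_ _)/wrap[].
  by case: (size p.2) pn.
move=> h; rewrite (splitr e).
apply: le_lt_trans (ltrD h (hz0 _ pS)).
apply: le_trans (ler_normD _ _); rewrite addrA subrK.
rewrite le_eqVlt; apply/orP; left; apply/eqP; congr (`| `|_| - _|).
case: p.2 => [|a s]/=; first by rewrite !big_ord0 scale0r !addr0.
by rewrite big_ord_recl/= addrA.
Qed.

Lemma itlim_modeled : modeled X (itlim 0).
Proof.
move=> S e e0.
have [z hz] := itlim_approx (\max_(s <- S) size s) [seq (0, s) | s <- S] e0.
exists z => s sS; have := hz _ (map_f _ sS); rewrite add0r; apply.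
exact: leq_bigmax_seq.
Qed.

End IteratedLimit.

(** The separation of U is used for the last condition: it keeps the differences [:: 1; -1], from
    which the next blocks are made, away from 0. *)
Lemma exists_spreading_model : infinite_dimensional X ->
  exists N, [/\ spreading N, modeled X N & 0 < N [:: 1; -1]].
Proof.
move=> /separated_ultrafilter[U [UU U1 Us]].
exists (itlim U 0); split; [exact: itlim_spreading|exact: itlim_modeled|].
apply: (@lt_le_trans _ _ 2^-1); first by rewrite invr_gt0.
apply: (cvgr_to_ge (@itlim_cvg _ UU U1 _ _ _)); apply: nearW => y.
apply: (cvgr_to_ge (@itlim_cvg _ UU U1 _ _ _)); apply: filterS (Us y) => z.
by rewrite add0r scale1r scaleN1r.
Qed.

End IteratedLimits.

(** * Unconditional models *)

Section Suppression.
Context (R : realType) (N : seq R -> R) (spN : spreading N).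

Lemma lscale_natS n (s : seq R) :
  lscale n.+1%:R s = ladd (lscale n%:R s) s.
Proof.
elim: s => //= a s ->; rewrite ladd_cons; congr (_ :: _).
by rewrite -natr1 mulrDl mul1r.
Qed.

(* Moving a block (a, -a) to the right M times and adding up telescopes to the
   block (a, 0, ..., 0, -a), whose norm does not depend on M. *)
Lemma suppression s t a :
  N (kron (s ++ t) [:: 1; -1]) <= N (kron (s ++ a :: t) [:: 1; -1]).
Proof.
rewrite !kron_cat kron_cons /= mulr1 mulrN1.
set S := kron s _; set T := kron t _.
pose V := N (S ++ [:: a, - a & T]); rewrite -/V.
have claim M : N (lscale M.+1%:R S ++ (a :: nseq M 0 ++ [:: - a]) ++
    lscale M.+1%:R T) <= M.+1%:R * V.
  elim: M => [|M IH]; first by rewrite mul1r !lscale1.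
  have -> : lscale M.+2%:R S ++ (a :: nseq M.+1 0 ++ [:: - a]) ++ lscale M.+2%:R T =
    ladd (lscale M.+1%:R S ++ (a :: nseq M 0 ++ [:: - a; 0]) ++ lscale M.+1%:R T)
         (S ++ (nseq M.+1 0 ++ [:: a; - a]) ++ T).
    have mid : ladd (a :: nseq M 0 ++ [:: - a; 0]) (nseq M.+1 0 ++ [:: a; - a]) =
        a :: nseq M.+1 0 ++ [:: - a].
      rewrite [nseq M.+1 0 ++ _]/= ladd_cons addr0; congr (_ :: _).
      rewrite ladd_cat ?size_nseq// ladd_nseq0 ?size_nseq//.
      by rewrite !ladd_cons addNr add0r -[in RHS]addn1 nseqD -catA.
    rewrite ladd_cat ?size_lscale// ladd_cat ?mid -?lscale_natS//.
    by rewrite /= !size_cat !size_nseq/= addnS.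
  rewrite (le_trans (spreadingD spN _))//.
    by rewrite !size_cat !size_lscale/= !size_cat !size_nseq/= !addnS.
  rewrite -[M.+2%:R]natr1 mulrDl mul1r lerD//.
    rewrite (le_trans _ IH)//.
    have := spreading0 spN (lscale M.+1%:R S ++ a :: nseq M 0 ++ [:: - a])
      (lscale M.+1%:R T).
    by rewrite -!catA /= -!catA /= => ->.
  by rewrite -catA spreading_nseq0.
have [//|VN] := leP.
have d0 : 0 < N (S ++ T) - V by rewrite subr_gt0.
pose C := N [:: a; - a].
(* A fixed gap times M+1 would stay below the norm of (a, -a), the zeros between the two entries
   being invisible. *)
have hM M : M.+1%:R * (N (S ++ T) - V) <= C.
  have sz : size (nseq M.+2 (0 : R)) = size (a :: nseq M 0 ++ [:: - a]).
    by rewrite /= size_cat !size_nseq/= addn1.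
  have := spreading_swap spN (lscale M.+1%:R S) (lscale M.+1%:R T) sz.
  rewrite spreading_nseq0// laddC ladd_nseq0; last first.
    by rewrite size_lscale -sz size_nseq.
  rewrite -lscale_cat !spreadingZ// normrN1 mul1r normr_nat.
  rewrite -[a :: nseq M 0 ++ _]cat1s spreading_nseq0//= => h.
  rewrite mulrBr lerBlDl (le_trans h)// lerD2r//; exact: claim.
have [n hn] : exists n : nat, C / (N (S ++ T) - V) < n%:R.
  by exists (Num.truncn (C / (N (S ++ T) - V))).+1; rewrite truncnS_gt.
have := hM n; rewrite -ler_pdivlMr// leNgt => /negP[].
by rewrite (lt_trans hn)// ltr_nat.
Qed.

Definition suppressing := forall s t a, N (s ++ t) <= N (s ++ a :: t).

Lemma suppressing_cons s t a r : suppressing -> 0 <= r <= 1 ->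
  N (s ++ r * a :: t) <= N (s ++ a :: t).
Proof.
move=> sN /andP[r0 r1].
have -> : s ++ r * a :: t = ladd (lscale r (s ++ a :: t)) (lscale (1 - r) (s ++ 0 :: t)).
  have h u : ladd (lscale r u) (lscale (1 - r) u) = u.
    by elim: u => //= b u IH; rewrite ladd_cons IH -mulrDl addrC subrK mul1r.
  by rewrite !lscale_cat/= ladd_cat ?size_lscale// ladd_cons !h mulr0 addr0.
rewrite (le_trans (spreadingD spN _))//.
  by rewrite !size_lscale !size_cat.
rewrite !spreadingZ// ger0_norm// ger0_norm ?subr_ge0// spreading0//.
have := ler_wpM2l (_ : 0 <= 1 - r) (sN s t a); rewrite subr_ge0 => /(_ r1).
move: (N (s ++ t)) (N (s ++ a :: t)) => x y; lra.
Qed.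

Lemma suppressing_mkseq s n (f g : nat -> R) : suppressing ->
  (forall i, exists2 r, 0 <= r <= 1 & f i = r * g i) ->
  N (s ++ mkseq f n) <= N (s ++ mkseq g n).
Proof.
move=> sN; elim: n s f g => [|n IH] s f g fg //.
have mkseqS h : mkseq h n.+1 = h 0%N :: mkseq (h \o S) n :> seq R.
  by rewrite /mkseq/= -[1%N]/(1 + 0)%N iotaDl -map_comp.
rewrite !mkseqS; have [r r01 ->] := fg 0%N.
rewrite (le_trans (suppressing_cons _ _ _ sN r01))//.
rewrite -!cat_rcons; apply: (IH _ (f \o S) (g \o S)) => i; exact: fg.
Qed.

(** f is the difference of (g + f) / 2 and (g - f) / 2, both multiples of g by factors in [0, 1];
    hence the constant 2. The weights c will be alternating signs. *)
Lemma suppressing_le2 n (f g : nat -> R) (c : nat -> R) : suppressing ->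
  (forall i, `|f i| <= g i) ->
  N (mkseq (fun i => c i * f i) n) <= 2 * N (mkseq (fun i => c i * g i) n).
Proof.
move=> sN fg.
pose h e i := c i * ((g i + e * f i) / 2).
have hN e : `|e| = 1 -> N (mkseq (h e) n) <= N (mkseq (fun i => c i * g i) n).
  move=> e1; apply: (@suppressing_mkseq [::]) => // i.
  have efg : `|e * f i| <= g i by rewrite normrM e1 mul1r.
  have [g0|g0] := eqVneq (g i) 0.
    exists 0; first by rewrite lexx ler01.
    by move: efg; rewrite /h g0 normr_le0 => /eqP ->; rewrite addr0 mul0r mulr0 mul0r.
  have gp : 0 < g i by rewrite lt_def g0 (le_trans (normr_ge0 _) (fg i)).
  exists ((g i + e * f i) / 2 / g i); last by rewrite /h; field.
  move: efg; rewrite ler_norml => /andP[h1 h2].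
  rewrite divr_ge0 ?(ltW gp)//=; last by rewrite divr_ge0// -lerBlDl sub0r.
  by rewrite ler_pdivrMr// ler_pdivrMr// mul1r mulr_natr mulr2n lerD2l.
have -> : mkseq (fun i => c i * f i) n =
    ladd (mkseq (h 1) n) (lscale (-1) (mkseq (h (-1)) n)).
  rewrite lscale_mkseq ladd_mkseq; by apply: eq_mkseq => i; rewrite /h; field.
rewrite (le_trans (spreadingD spN _)) ?size_lscale ?size_mkseq//.
rewrite spreadingZ// normrN1 mul1r mulr_natl mulr2n lerD// hN//.
  by rewrite normr1.
by rewrite normrN1.
Qed.

End Suppression.

(** * Almost shift-invariant weights *)

Section Folner.
Context (R : realType).
Implicit Types (w : nat -> nat -> R).

Definition shift1 w a b := if a is a'.+1 then w a' b else 0.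
Definition shift2 w a b := if b is b'.+1 then w a b' else 0.
Definition delta i j : nat -> nat -> R := fun a b => ((a == i) && (b == j))%:R.
(** q^|a - m|, cut off beyond 2m; one of the two truncated differences is always 0. *)
Definition tent (q : R) m a := if (a <= m.*2)%N then q ^+ (a - m + (m - a)) else 0.
Definition tent2 q m a b := tent q m a * tent q m b.

Context (eta q : R).
Hypotheses (eta0 : 0 < eta) (qE : q = (1 + eta)^-1).

Let q0 : 0 < q. Proof. by rewrite qE invr_gt0 addr_gt0. Qed.
Let q1 : q <= 1. Proof. by rewrite qE invf_le1 ?lerDl ?(ltW eta0)// addr_gt0. Qed.
Let qB : 1 - q = q * eta.
Proof. by rewrite qE; field; rewrite gt_eqF// addr_gt0. Qed.

Lemma tent_ge0 m a : 0 <= tent q m a.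
Proof. by rewrite /tent; case: ifP => // _; rewrite exprn_ge0// ltW. Qed.

Lemma tent_le1 m a : tent q m a <= (a <= m.*2)%:R.
Proof. by rewrite /tent; case: ifP => // _; rewrite exprn_ile1// ltW. Qed.

Lemma tent_mid m : tent q m m = 1.
Proof. by rewrite /tent -addnn leq_addr subnn. Qed.

Let tent_step m a b :
  `|shift1 (tent2 q m) a b - tent2 q m a b| <= eta * tent2 q m a b +
    q ^+ m * (((a == 0)%N || (a == m.*2.+1)) && (b <= m.*2)%N)%:R.
Proof.
have tb := tent_le1 m b; have tb0 := tent_ge0 m b.
case: a => [|a] /=.
  rewrite sub0r normrN ger0_norm ?mulr_ge0 ?tent_ge0//.
  rewrite ler_wpDl ?mulr_ge0 ?tent_ge0 ?(ltW eta0)//.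
  by rewrite /tent2 {1}/tent leq0n sub0n add0n subn0 ler_wpM2l// exprn_ge0// ltW.
rewrite /tent2 -mulrBl normrM (ger0_norm tb0) mulrA.
have [am|am] := leqP a.+1 m.*2; last first.
  have -> : tent q m a.+1 = 0 by rewrite /tent leqNgt am.
  rewrite subr0 mulr0 mul0r add0r ger0_norm ?tent_ge0// eqSS.
  move: am; rewrite ltnS leq_eqVlt => /orP[/eqP <-|am].
    rewrite eqxx/= /tent leqnn -addnn addnK subnDA subnn sub0n addn0 -/(tent q m b) addnn.
    by rewrite ler_wpM2l// exprn_ge0// ltW.
  by rewrite {1}/tent leqNgt am mul0r gtn_eqF// mulr0.
apply: le_trans (_ : eta * tent q m a.+1 * tent q m b <= _); last first.
  by rewrite lerDl mulr_ge0// exprn_ge0// ltW.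
rewrite ler_wpM2r// /tent am (ltnW am).
have [ma|ma] := leqP m a.
  have -> : (a - m + (m - a))%N = (a - m)%N by lia.
  have -> : (a.+1 - m + (m - a.+1))%N = (a - m).+1 by lia.
  rewrite exprS -[X in X - _]mul1r -mulrBl qB normrM ger0_norm; last first.
    by rewrite mulr_ge0 ?ltW.
  by rewrite ger0_norm ?exprn_ge0 ?(ltW q0)// mulrA [eta * q]mulrC.
have -> : (a - m + (m - a))%N = (m - a.+1).+1 by lia.
have -> : (a.+1 - m + (m - a.+1))%N = (m - a.+1)%N by lia.
rewrite exprS distrC -[X in X - _]mul1r -mulrBl normrM qB ger0_norm.
  by rewrite ger0_norm ?exprn_ge0 ?(ltW q0)// ler_wpM2r ?exprn_ge0 ?(ltW q0)// ler_piMl// ltW.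
by rewrite mulr_ge0 ?ltW.
Qed.

Section OneShift.
Context (F : (nat -> nat -> R) -> R).
Hypotheses (FD : forall w w', F (fun a b => w a b + w' a b) <= F w + F w')
  (FZ : forall c w, F (fun a b => c * w a b) = `|c| * F w)
  (FM : forall w w', (forall a b, `|w a b| <= w' a b) -> F w <= 2 * F w').

Let F_sum n (f : nat -> nat -> nat -> R) :
  F (fun a b => \sum_(j < n) f j a b) <= \sum_(j < n) F (f j).
Proof.
elim: n => [|n IH].
  rewrite big_ord0 (_ : (fun _ _ => _) = (fun a b => 0 * delta 0 0 a b)).
    by rewrite FZ normr0 mul0r.
  by apply/funext => a; apply/funext => b; rewrite big_ord0 mul0r.
rewrite big_ord_recr/= (_ : (fun _ _ => _) = fun a b => \sum_(j < n) f j a b + f n a b).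
  by rewrite (le_trans (FD _ _))// lerD2r.
by apply/funext => a; apply/funext => b; rewrite big_ord_recr.
Qed.

(* A tent is multiplied by q^(+-1) by a shift, except at its ends where it is of
   size q^m; this beats the slow growth of F (delta i j). *)
Lemma folner1 m G :
  (forall i j, (i <= m.*2.+1)%N -> (j <= m.*2.+1)%N -> F (delta i j) <= G) ->
  8 * (m.*2.+1%:R * q ^+ m) * G <= eta * F (delta m m) ->
  F (fun a b => shift1 (tent2 q m) a b - tent2 q m a b) <= 3 * eta * F (tent2 q m) /\
  F (delta m m) <= 2 * F (tent2 q m).
Proof.
move=> FG hG.
have dmm : F (delta m m) <= 2 * F (tent2 q m).
  apply: FM => a b; rewrite /delta; case: eqP => [->|] /=; last first.
    by rewrite normr0 mulr_ge0 ?tent_ge0.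
  case: eqP => [->|] /=; last by rewrite normr0 mulr_ge0 ?tent_ge0.
  by rewrite /tent2 !tent_mid mulr1 normr1.
split => //.
pose bd a b := \sum_(j < m.*2.+1) (delta 0 j a b + delta m.*2.+1 j a b).
have bdE a b : (((a == 0)%N || (a == m.*2.+1)) && (b <= m.*2)%N)%:R = bd a b.
  rewrite /bd; have [bm|bm] := leqP b m.*2.
    rewrite (bigD1 (Ordinal (bm : (b < m.*2.+1)%N)))//= big1 => [|j jb].
      rewrite addr0 /delta eqxx !andbT; case: a => [|a]; by rewrite /= ?addr0 ?add0r.
    rewrite /delta [b == _](_ : _ = false) ?andbF ?addr0//.
    by apply/negP => /eqP bj; case/negP: jb; apply/eqP/val_inj.
  rewrite andbF big1// => j _.
  by rewrite /delta [b == _]gtn_eqF ?andbF ?addr0// (leq_trans (ltn_ord j)).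
have Fbd : F bd <= m.*2.+1%:R * (G + G).
  apply: (le_trans (@F_sum m.*2.+1 (fun j a b => delta 0 j a b + delta m.*2.+1 j a b))).
  rewrite -[m.*2.+1 in leRHS]card_ord -sum1_card natr_sum mulr_suml.
  apply: ler_sum => j _; rewrite mul1r (le_trans (FD _ _))// lerD// FG//; exact: ltnW.
(* The interior contributes 2 eta F (tent2 q m). The ends contribute at most 4 (2m+1) q^m G, which
   is at most half of eta F (delta m m), hence at most eta F (tent2 q m). This is the origin of 3
   and 8. *)
apply: le_trans (FM (w' := fun a b => eta * tent2 q m a b + q ^+ m * bd a b) _) _.
  by move=> a b; rewrite -bdE; exact: tent_step.
have h1 := FD (fun a b => eta * tent2 q m a b) (fun a b => q ^+ m * bd a b).
rewrite (le_trans (ler_wpM2l _ h1))// !FZ (gtr0_norm eta0) gtr0_norm ?exprn_gt0//.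
have := ler_wpM2l (ltW (exprn_gt0 m q0)) Fbd.
move: dmm hG; move: (F _) (F _) (F _) => x y z.
have : 0 < q ^+ m by exact: exprn_gt0.
move: (q ^+ m) (m.*2.+1%:R) => Q K Q0 h2 h3 h4.
have h5 := ler_wpM2l (ltW eta0) h2.
have e1 : 8 * (K * Q) * G = 4 * (Q * (K * (G + G))) by ring.
rewrite e1 in h3.
have e2 : eta * (2 * y) = 2 * (eta * y) by ring.
have e3 : 3 * eta * y = 3 * (eta * y) by ring.
rewrite e2 in h5; rewrite e3; lra.
Qed.

End OneShift.

(** Since [tent2] is symmetric, exchanging the variables in F reduces the second shift to the first.
    Monotonicity is asked only up to a factor 2 in order to cover sums with alternating signs, where
    no unconditional norm is available yet. *)
Lemma folner (F : (nat -> nat -> R) -> R) m G :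
  (forall w w', F (fun a b => w a b + w' a b) <= F w + F w') ->
  (forall c w, F (fun a b => c * w a b) = `|c| * F w) ->
  (forall w w', (forall a b, `|w a b| <= w' a b) -> F w <= 2 * F w') ->
  (forall i j, (i <= m.*2.+1)%N -> (j <= m.*2.+1)%N -> F (delta i j) <= G) ->
  8 * (m.*2.+1%:R * q ^+ m) * G <= eta * F (delta m m) ->
  [/\ F (fun a b => shift1 (tent2 q m) a b - tent2 q m a b) <= 3 * eta * F (tent2 q m),
      F (fun a b => shift2 (tent2 q m) a b - tent2 q m a b) <= 3 * eta * F (tent2 q m) &
      F (delta m m) <= 2 * F (tent2 q m)].
Proof.
move=> FD FZ FM FG hG; have [h1 h3] := folner1 FD FZ FM FG hG; split => //.
pose F' w := F (fun a b => w b a).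
have deltaC i j : (fun a b => delta i j b a) = delta j i.
  by apply/funext => a; apply/funext => b; rewrite /delta andbC.
have [] := @folner1 F' _ _ _ m G.
- by move=> w w'; exact: FD.
- by move=> c w; exact: FZ.
- by move=> w w' ww'; exact: FM.
- by move=> i j im jm; rewrite /F' deltaC FG.
- by rewrite /F' deltaC.
have tC : (fun a b => tent2 q m b a) = tent2 q m.
  by apply/funext => a; apply/funext => b; rewrite /tent2 mulrC.
rewrite /F' tC; set f := (fun a b => _) => h _.
rewrite (_ : (fun a b => _) = f)//.
by apply/funext => a; apply/funext => b; rewrite /f -[in RHS]tC; case: b => //= b; rewrite tC.
Qed.

End Folner.

(** * From suppression to invariance under signs *)

Section Monotone.
Context (R : realType).

Definition solid (N : seq R -> R) := forall s t, size s = size t ->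
  (forall i, `|s`_i| <= `|t`_i|) -> N s <= N t.

(** If |a| <= |b|, then a is a convex combination of b and -b; the entries are replaced one at a
    time. *)
Lemma sign_invariant_solid (N : seq R -> R) : spreading N ->
  (forall s t a, N (s ++ - a :: t) <= N (s ++ a :: t)) -> solid N.
Proof.
move=> spN sN.
have step s t a b : `|a| <= `|b| -> N (s ++ a :: t) <= N (s ++ b :: t).
  move=> ab; have [b0|b0] := eqVneq b 0.
    by move: ab; rewrite b0 normr0 normr_le0 => /eqP ->.
  pose r := a / b.
  have ar : a = r * b by rewrite /r divfK.
  have : `|r| <= 1 by rewrite normrM normfV ler_pdivrMr ?normr_gt0// mul1r.
  rewrite ler_norml => /andP[r1 r2].
  have -> : s ++ a :: t = ladd (lscale ((1 + r) / 2) (s ++ b :: t))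
      (lscale ((1 - r) / 2) (s ++ - b :: t)).
    have h u : ladd (lscale ((1 + r) / 2) u) (lscale ((1 - r) / 2) u) = u.
      elim: u => //= c u IH; rewrite ladd_cons IH; congr (_ :: _); by field.
    rewrite !lscale_cat/= ladd_cat ?size_lscale// ladd_cons !h ar.
    by congr (_ ++ _ :: _); field.
  rewrite (le_trans (spreadingD spN _))// ?size_lscale ?size_cat//.
  rewrite !spreadingZ// ger0_norm; last by rewrite divr_ge0//; lra.
  rewrite ger0_norm; last by rewrite divr_ge0//; lra.
  have := ler_wpM2l (_ : 0 <= (1 - r) / 2) (sN s t b).
  rewrite divr_ge0//; last lra.
  move=> /(_ isT); lra.
suff gen s : forall u t, size s = size t -> (forall i, `|s`_i| <= `|t`_i|) ->
    N (u ++ s) <= N (u ++ t) by move=> s t; exact: (gen s [::]).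
elim: s => [|a s IH] u [|b t]// [st] h.
rewrite (le_trans (step u s a b _))//; first exact: (h 0%N).
by rewrite -!cat_rcons IH// => i; exact: (h i.+1).
Qed.

Lemma spreading_single (N : seq R -> R) n k (c : nat -> R) : spreading N ->
  (k < n)%N -> N (mkseq (fun i => (i == k)%:R * c i) n) = `|c k| * N [:: 1].
Proof.
move=> spN kn.
have -> : mkseq (fun i => (i == k)%:R * c i) n =
    nseq k 0 ++ [:: c k] ++ nseq (n - k.+1) 0.
  apply: (@eq_from_nth _ 0).
    by rewrite size_mkseq !size_cat !size_nseq/= addnS -addSn subnKC.
  move=> i; rewrite size_mkseq => ni; rewrite nth_mkseq// nth_cat size_nseq.
  rewrite nth_nseq; case: ltngtP => [ik|ki|->].
  - by rewrite mul0r.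
  - rewrite mul0r; have -> : (i - k)%N = (i - k).-1.+1 by rewrite prednK// subn_gt0.
    by rewrite /= nth_nseq if_same.
  - by rewrite mul1r subnn.
rewrite (spreading_pad spN _ _ _ 0).1 -spreadingZ//.
by rewrite /lscale/= mulr1.
Qed.

Lemma bernoulli_ineq (x : R) n : 0 <= x -> 1 + n%:R * x <= (1 + x) ^+ n.
Proof.
move=> x0; elim: n => [|n IH]; first by rewrite mul0r addr0 expr0.
rewrite exprS (le_trans _ (ler_wpM2l _ IH))//; last by rewrite addr_ge0.
have : 0 <= n%:R * (x * x) by rewrite !mulr_ge0.
rewrite -natr1; lra.
Qed.

Lemma linear_geometric (x : R) : 0 < x ->
  exists2 C, 0 < C & forall m, m.*2.+1%:R <= C * (1 + x) ^+ m.
Proof.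
move=> x0; exists (1 + 2 / x); first by rewrite addr_gt0// divr_gt0.
move=> m; rewrite (le_trans _ (ler_wpM2l _ (bernoulli_ineq m (ltW x0))))//.
  rewrite -addn1 -muln2 natrD natrM.
  have e : (1 + 2 / x) * (1 + m%:R * x) = 1 + m%:R * 2 + (m%:R * x + 2 / x).
    by field; rewrite gt_eqF.
  by rewrite e [leLHS]addrC lerDl addr_ge0 ?mulr_ge0 ?invr_ge0 ?(ltW x0).
by rewrite addr_ge0// divr_ge0// ltW.
Qed.

(** Write 1 + x = (1 + y)^2: one factor (1 + y)^m absorbs the linear growth, the other makes the
    quotient small. *)
Lemma linear_geometric_lt (x K : R) : 0 < x -> 0 < K ->
  exists m, m.*2.+1%:R * (1 + x) ^- m <= K.
Proof.
move=> x0 K0.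
pose y := Num.sqrt (1 + x) - 1.
have y0 : 0 < y.
  by rewrite subr_gt0 -[ltLHS](sqrtr1 R) ltr_sqrt ?addr_gt0// ltrDl.
have yE : 1 + x = (1 + y) ^+ 2.
  by rewrite /y [1 + (_ - 1)]addrC subrK sqr_sqrtr// addr_ge0// ltW.
have [C C0 hC] := linear_geometric y0.
have [m hm] : exists m : nat, C / K / y < m%:R.
  by exists (Num.truncn (C / K / y)).+1; rewrite truncnS_gt.
exists m; rewrite yE -exprM mulnC exprM expr2 invfM.
set z := (1 + y) ^+ m; have z0 : 0 < z by rewrite exprn_gt0// addr_gt0.
rewrite mulrA ler_pdivrMr// ler_pdivrMr// (le_trans (hC m))// ler_wpM2r ?(ltW z0)//.
rewrite mulrC -ler_pdivrMr// (le_trans _ (bernoulli_ineq m (ltW y0)))//.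
by move: hm; rewrite ltr_pdivrMr// => /ltW h; rewrite (le_trans h)// lerDr.
Qed.

(* The almost shift-invariant tent, with alternating signs. *)
Lemma sign_block (N : seq R -> R) e : spreading N -> suppressing N ->
  0 < N [:: 1] -> 0 < e ->
  exists2 u, 0 < N u & N (ladd (rcons u 0) (0 :: u)) <= e * N u.
Proof.
move=> spN sN N1 e0.
pose eta := e / 3; have eta0 : 0 < eta by rewrite divr_gt0.
pose q := (1 + eta)^-1.
have [m hm] := linear_geometric_lt eta0 (divr_gt0 eta0 (ltr0n R 8)).
have mm : (m <= m.*2.+1)%N by lia.
(* The tent occupies 2m+1 places; one more makes room for its shift. *)
pose n := m.*2.+2.
(* Only the first shift is wanted, so the second variable is summed out. If u_i = (-1)^i t_i, the
   sum of u and its translate has the entries (-1)^i (t_i - t_(i-1)). *)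
pose F (w : nat -> nat -> R) :=
  N (mkseq (fun i => (-1) ^+ i * \sum_(b < n) w i b) n).
have Fdelta i j : (i <= m.*2.+1)%N -> (j <= m.*2.+1)%N -> F (delta R i j) = N [:: 1].
  move=> im jm; rewrite /F.
  have := @spreading_single N n i (fun i => (-1) ^+ i) spN im.
  rewrite normrX normrN1 expr1n mul1r => <-; congr (N _); apply: eq_mkseq => k.
  rewrite mulrC (bigD1 (Ordinal (jm : (j < n)%N)))//= big1 => [|b bj].
    by rewrite addr0 /delta eqxx andbT.
  by rewrite /delta [nat_of_ord b == _](negbTE bj) andbF.
have [|||||FS _ Fmm] := @folner R eta q eta0 erefl F m (N [:: 1]).
- move=> w w'; rewrite /F (le_trans _ (spreadingD spN _)) ?size_mkseq//.
  rewrite ladd_mkseq le_eqVlt; apply/orP; left; apply/eqP; congr (N _).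
  by apply: eq_mkseq => i; rewrite big_split mulrDr.
- move=> c w; rewrite /F -spreadingZ// lscale_mkseq; congr (N _).
  by apply: eq_mkseq => i; rewrite -mulr_sumr mulrCA.
- move=> w w' ww'; apply: suppressing_le2 => // i.
  by rewrite (le_trans (ler_norm_sum _ _ _))// ler_sum.
- by move=> i j im jm; rewrite Fdelta.
- by rewrite Fdelta// ler_wpM2r ?(ltW N1)// mulrC -ler_pdivlMr// /q exprVn.
pose f i := (-1) ^+ i * \sum_(b < n) tent2 q m i b.
have fn : f m.*2.+1 = 0.
  by rewrite /f big1 ?mulr0// => b _; rewrite /tent2 {1}/tent ltnn mul0r.
have [u uE] : {u | u = mkseq f m.*2.+1} by exists (mkseq f m.*2.+1).
have su : size u = m.*2.+1 by rewrite uE size_mkseq.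
have uF : N u = F (tent2 q m).
  rewrite -[RHS]/(N (mkseq f m.*2.+2)) mkseqS fn -uE -cats1 -[[:: 0]]/(nseq 1 0).
  by rewrite spreading_cat0.
exists u.
  rewrite uF -(pmulr_rgt0 _ (ltr0n R 2 : 0 < 2%:R)) (lt_le_trans _ Fmm)//.
  by rewrite Fdelta.
rewrite uF; apply: le_trans (_ : 3 * eta * F (tent2 q m) <= _); last first.
  by rewrite /eta [3 * _]mulrC divfK.
apply: le_trans FS; rewrite le_eqVlt; apply/orP; left; apply/eqP.
transitivity (N (lscale (-1) (mkseq (fun i => (-1) ^+ i *
    \sum_(b < n) (shift1 (tent2 q m) i b - tent2 q m i b)) n))); last first.
  by rewrite spreadingZ// normrN1 mul1r.
have sl : size (ladd (rcons u 0) (0 :: u)) = n.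
  by rewrite size_ladd size_rcons /= su minnn.
rewrite lscale_mkseq; congr (N _).
apply: (@eq_from_nth _ 0).
  by rewrite sl [RHS]size_mkseq.
move=> i; rewrite sl => ni.
rewrite nth_mkseq// (nth_map (0, 0)); last first.
  by rewrite -(size_map (fun p => p.1 + p.2)) -/(ladd _ _) sl.
rewrite nth_zip ?size_rcons//= nth_rcons su if_same.
have -> : (if (i < m.*2.+1)%N then u`_i else 0) = f i.
  case: ltnP => im; first by rewrite uE nth_mkseq.
  by have -> : i = m.*2.+1; [apply/eqP; rewrite eqn_leq im -ltnS ni|].
under eq_bigr do rewrite -[_ - _]opprB.
rewrite sumrN mulrN mulN1r opprK sumrB mulrBr -/(f i); congr (_ + _).
case: i ni => [|i] ni /=; first by rewrite big1 ?mulr0 ?oppr0// nth_nil.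
by rewrite uE nth_mkseq// exprS mulN1r mulNr opprK.
Qed.

(** When u plus its translate by one place is negligible, -u is almost a translate of u, and a
    spreading norm does not see translations. Hence changing the sign of a coefficient of a sequence
    of blocks u costs little, and nothing in the limit. *)
Lemma exists_solid_model (X : completeNormedModType R) :
  infinite_dimensional X ->
  exists N, [/\ spreading N, solid N, modeled X N & N [:: 1] = 1].
Proof.
move=> /exists_spreading_model[N0 [spN0 mN0 N0d]].
pose N1 s := N0 (kron s [:: 1; -1]).
have spN1 : spreading N1 by exact: spreading_kron.
have sN1 : suppressing N1 by move=> s t a; exact: suppression.
have N1p : 0 < N1 [:: 1] by rewrite /N1 /kron/= !mul1r.
have /choice[u hu] : forall m : nat, exists u, 0 < N1 u /\
    N1 (ladd (rcons u 0) (0 :: u)) <= m.+1%:R^-1 * N1 u.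
  move=> m; have [u u0 hu] := sign_block (e := m.+1%:R^-1) spN1 sN1 N1p (ltac:(by [])).
  by exists u.
have [|N [spN mN NE NN]] := @ultralimit R X (fun m s => N1 (kron s (u m)) / N1 (u m)).
  move=> m; have [u0 _] := hu m; split.
  - by apply: (@spreading_scale _ (fun s => N1 (kron s (u m)))) (ltW u0); exact: spreading_kron.
  - apply: (@modeled_scale _ _ (fun s => N1 (kron s (u m)))) => //.
    by apply: modeled_kron; exact: modeled_kron.
  - by rewrite /kron/= cats0 lscale1 divff// gt_eqF.
exists N; split => //.
apply: sign_invariant_solid => // s t a; apply: NN => e e0.
have : \forall m \near \oo, `|a| * m.+1%:R^-1 < e.
  have a1 : 0 < `|a| + 1 by rewrite ltr_wpDl.
  have := @near_infty_natSinv_lt R (PosNum (divr_gt0 e0 a1)).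
  apply: filterS => m /=; rewrite ltr_pdivlMr// => h.
  by rewrite (le_lt_trans _ h)// mulrC ler_wpM2l// lerDl.
apply: filterS => m me; have [u0 hm] := hu m.
rewrite -lerBlDl -mulrBl ler_pdivrMr// lerBlDl.
apply: le_trans (_ : _ <= N1 (kron (s ++ a :: t) (u m)) +
    `|a| * N1 (ladd (rcons (u m) 0) (0 :: u m))) _; last first.
  rewrite lerD2l (le_trans (ler_wpM2l _ hm))// mulrA ler_wpM2r ?(ltW u0)//; exact: ltW.
rewrite !kron_cat !kron_cons.
set S := kron s _; set T := kron t _; set v := u m.
have -> : N1 (S ++ lscale (- a) v ++ T) = N1 (S ++ (0 :: lscale (- a) v) ++ T).
  by rewrite /= spreading0.
have -> : N1 (S ++ lscale a v ++ T) = N1 (S ++ rcons (lscale a v) 0 ++ T).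
  by rewrite cat_rcons !catA spreading0.
rewrite (le_trans (spreading_swap spN1 _ _ (y := rcons (lscale a v) 0) _))//.
  by rewrite /= size_rcons !size_lscale.
rewrite lerD2l -normrN -spreadingZ// laddC le_eqVlt; apply/orP; left; apply/eqP; congr (N1 _).
rewrite lscale_ladd /lscale/= !map_rcons -map_comp/= !mulr0.
by congr (ladd (rcons _ _) _); apply: eq_map => x /=; ring.
Qed.

End Monotone.

(** * Krivine's dilations *)

Section Growth.
Context (R : realType) (N : seq R -> R).
Hypotheses (spN : spreading N) (soN : solid N) (N1 : N [:: 1] = 1).

(** The fundamental function of N. *)
Definition phi K := N (nseq K 1).

Lemma phi_le K : phi K <= K%:R.
Proof.
rewrite /phi (le_trans (spreading_le spN _))// N1 mul1r.
elim: K => [|K IH]; first by rewrite big_nil.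
by rewrite /= big_cons normr1 -natr1 addrC lerD2r.
Qed.

Lemma phi_nondecreasing K L : (K <= L)%N -> phi K <= phi L.
Proof.
move=> KL; rewrite /phi -(spreading_cat0 spN (L - K)).
apply: soN; first by rewrite size_cat !size_nseq subnKC.
move=> i; rewrite nth_cat size_nseq !nth_nseq; case: ltnP => iK.
  by rewrite (leq_trans iK KL).
by rewrite if_same normr0.
Qed.

Lemma phi_ge1 K : (0 < K)%N -> 1 <= phi K.
Proof. by move=> K0; rewrite -N1 (phi_nondecreasing K0). Qed.

(** a is the infimum of the b >= 0 such that phi K = O(K^b). As a - d is not such an exponent, phi K
    is large for some K; monotonicity moves K up to the next power of B, at the cost of a factor at
    most B. If a - d < 0, then (B^(a-d))^m tends to 0 while phi is at least 1. *)
Lemma growth_exponent : exists2 a : R, 0 <= a <= 1 & forall d, 0 < d ->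
  (exists2 D, 0 < D & forall K, (0 < K)%N -> phi K <= D * K%:R `^ (a + d)) /\
  (forall (B : nat) D, (1 < B)%N -> 0 < D ->
     exists m, D * (B%:R `^ (a - d)) ^+ m <= phi (B ^ m)).
Proof.
pose S := [set b : R | 0 <= b /\ exists2 D, 0 < D &
  forall K, (0 < K)%N -> phi K <= D * K%:R `^ b].
have S1 : S 1.
  split => //; exists 1 => // K K0; rewrite mul1r powRr1//; exact: phi_le.
have Sinf : has_inf S by split; [exists 1|exists 0 => b []].
have a0 : 0 <= inf S by apply: lb_le_inf; [exists 1|move=> b []].
have a1 : inf S <= 1 by apply: ge_inf => //; exact: Sinf.2.
exists (inf S); first by rewrite a0.
move=> d d0; split.
  have [b [b0 [D D0 hD]] bd] := inf_adherent d0 Sinf.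
  exists D => // K K0; rewrite (le_trans (hD _ K0))// ler_wpM2l ?(ltW D0)//.
  by apply: ler_powR (ltW bd); rewrite ler1n.
move=> B D B1 D0.
have B0 : 0 < B%:R :> R by rewrite ltr0n ltnW.
set t := B%:R `^ (inf S - d).
have t0 : 0 < t by exact: powR_gt0.
have [ad|ad] := leP 0 (inf S - d).
  have nS : ~ S (inf S - d).
    by move=> /(ge_inf Sinf.2); rewrite lerBrDl gerDr leNgt d0.
  have [K [K0 hK]] : exists K, (0 < K)%N /\ D * B%:R * K%:R `^ (inf S - d) < phi K.
    apply: contrapT => h; apply: nS; split => //; exists (D * B%:R).
      by rewrite mulr_gt0.
    by move=> K K0; rewrite leNgt; apply/negP => hK; apply: h; exists K.
  have t1 : t <= B%:R.
    rewrite -[leRHS]powRr1 ?(ltW B0)// ler_powR ?ler1n 1?ltnW//.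
    by rewrite lerBlDr (le_trans a1)// lerDl ltW.
  exists (trunc_log B K).+1.
  rewrite (le_trans _ (phi_nondecreasing (ltnW (trunc_log_ltn K B1))))//.
  rewrite (le_trans _ (ltW hK))// exprSr mulrA mulrAC.
  apply: ler_pM; rewrite ?mulr_ge0 ?exprn_ge0 ?(ltW D0) ?(ltW t0)//.
    by rewrite ler_wpM2l// ltW.
  rewrite -powR_mulrn ?(ltW t0)// /t powRAC powR_mulrn ?(ltW B0)// -natrX.
  by rewrite ge0_ler_powR ?nnegrE// ler_nat trunc_logP.
have t1 : t < 1.
  by rewrite -(powRr0 (B%:R : R)) /t -ltr_ln ?posrE ?powR_gt0// !ln_powR mul0r nmulr_rlt0// ln_gt0// ltr1n.
have x0 : 0 < t^-1 - 1 by rewrite subr_gt0 invf_gt1.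
have D1 : 0 < D^-1 by rewrite invr_gt0.
have [m hm] := linear_geometric_lt x0 D1.
exists m; apply: le_trans (phi_ge1 _); last by rewrite expn_gt0 (ltnW B1).
rewrite mulrC -ler_pdivlMr// div1r (le_trans _ hm)//.
rewrite [1 + _]addrC subrK -exprVn invrK ler_peMl ?exprn_ge0 ?(ltW t0)//.
by rewrite ler1n.
Qed.

End Growth.

(** * Dilations *)

Section Dilations.
Context (R : realType).

Lemma mkseq_refine (N : seq R -> R) n c (f : nat -> R) s t : spreading N ->
  (0 < c)%N -> (forall i, ~~ (c %| i)%N -> f i = 0) ->
  N (s ++ mkseq f (n * c) ++ t) = N (s ++ mkseq (fun i => f (i * c)%N) n ++ t).
Proof.
move=> spN; case: c => // c _ fc; elim: n t => [|n IH] t //.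
have -> : mkseq f (n.+1 * c.+1) =
    mkseq f (n * c.+1) ++ f (n * c.+1)%N :: nseq c 0.
  apply: (@eq_from_nth _ 0).
    by rewrite size_cat !size_mkseq [size (_ :: _)]/= size_nseq mulSn addnC.
  move=> i; rewrite size_mkseq => ni; rewrite nth_mkseq// nth_cat size_mkseq.
  case: ltnP => h; first by rewrite nth_mkseq.
  have [->|ne] := eqVneq i (n * c.+1)%N; first by rewrite subnn.
  have {}h : (n * c.+1 < i)%N by rewrite ltn_neqAle eq_sym ne.
  rewrite -(subnK h) addnS -addSn addnK /= nth_nseq if_same.
  apply: fc; rewrite dvdn_addl ?dvdn_mull//.
  by apply/negP => /dvdn_leq; move: ni h; lia.
have e := spreading_nseq0 spN c (s ++ mkseq f (n * c.+1) ++ [:: f (n * c.+1)%N]) t.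
rewrite -!catA in e; rewrite mkseqS cat_rcons -IH -!catA cat_cons; exact: e.
Qed.

Lemma mkseq_periodic k D (g : nat -> R) : (forall i, g (i + D)%N = g i) ->
  mkseq g (k * D) = flatten (nseq k (mkseq g D)).
Proof.
move=> gD; elim: k => //= k <-; rewrite mulSn /mkseq iotaD map_cat; congr (_ ++ _).
by rewrite add0n -[D in iota D]addn0 iotaDl -map_comp; apply: eq_map => i /=; rewrite addnC gD.
Qed.

Lemma kron_nseq k c (u : seq R) : kron (nseq k c) u = flatten (nseq k (lscale c u)).
Proof. by rewrite /kron map_nseq. Qed.

Section Dilation.
Context (k l : nat) (k0 : (0 < k)%N) (l0 : (0 < l)%N).

(* \sum_(a, b) w a b T_(k^a l^b) e, where T_K e is the indicator function of the
   multiples of 1/K in [0,1), sampled at the multiples of 1/D; D should be a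
   multiple of the k^a l^b. *)
Definition dilations n (w : nat -> nat -> R) D i : R :=
  \sum_(a < n) \sum_(b < n) w a b * (D %| i * (k ^ a * l ^ b))%:R.

Let K_gt0 a b : (0 < k ^ a * l ^ b)%N.
Proof. by rewrite muln_gt0 !expn_gt0 k0 l0. Qed.

Lemma dilations_periodic n w D i : dilations n w D (i + D) = dilations n w D i.
Proof.
apply: eq_bigr => a _; apply: eq_bigr => b _; congr (_ * _%:R).
by rewrite mulnDl dvdn_addl// dvdn_mulr.
Qed.

(** D is just a common denominator: as all the k^a l^b divide it, a finer sampling only inserts
    zeros. *)
Lemma dilations_refine N n w D c s t d : spreading N -> (0 < c)%N -> (0 < D)%N ->
  (forall a b, (a < n)%N -> (b < n)%N -> (k ^ a * l ^ b %| D)%N) ->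
  N (s ++ lscale d (mkseq (dilations n w (D * c)) (D * c)) ++ t) =
  N (s ++ lscale d (mkseq (dilations n w D) D) ++ t).
Proof.
move=> spN c0 D0 hD; rewrite !lscale_mkseq mkseq_refine//.
  congr (N (_ ++ _ ++ _)); apply: eq_mkseq => i; congr (_ * _).
  apply: eq_bigr => a _; apply: eq_bigr => b _; congr (_ * _%:R).
  by rewrite mulnAC dvdn_pmul2r.
move=> i ci; rewrite /dilations big1 ?mulr0// => a _; rewrite big1// => b _.
case: (boolP (_ %| _)%N) => [h|_]; last by rewrite mulr0.
case/negP: ci; have /dvdnP[E DE] := hD a b (ltn_ord a) (ltn_ord b).
move: h; rewrite DE mulnAC [(i * _)%N]mulnC [(E * c * _)%N]mulnC dvdn_pmul2l//.
exact: dvdn_trans (dvdn_mull _ (dvdnn c)).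
Qed.

(** k copies in a row, rescaled to [0, 1), are the image under T_k, and T_k shifts w in its first
    variable. The weights vanish at n so that none is shifted out of range. *)
Lemma dilations_copies1 n w D : (forall b, w n b = 0) -> (0 < D)%N ->
  flatten (nseq k (mkseq (dilations n.+1 w D) D)) =
  mkseq (dilations n.+1 (shift1 w) (k * D)) (k * D).
Proof.
move=> wn D0; rewrite -mkseq_periodic; last exact: dilations_periodic.
apply: eq_mkseq => i; rewrite /dilations [LHS]big_ord_recr [RHS]big_ord_recl.
rewrite [X in _ + X = _]big1 ?addr0; last by move=> b _; rewrite wn mul0r.
rewrite [X in _ = X + _]big1 ?add0r; last by move=> b _; rewrite mul0r.
apply: eq_bigr => a _; apply: eq_bigr => b _; congr (_ * _%:R).
by rewrite /= /bump/= add1n expnS -mulnA [in RHS](mulnCA i) dvdn_pmul2l.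
Qed.

Lemma dilations_copies2 n w D : (forall a, w a n = 0) -> (0 < D)%N ->
  flatten (nseq l (mkseq (dilations n.+1 w D) D)) =
  mkseq (dilations n.+1 (shift2 w) (l * D)) (l * D).
Proof.
move=> wn D0; rewrite -mkseq_periodic; last exact: dilations_periodic.
apply: eq_mkseq => i; rewrite /dilations; apply: eq_bigr => a _.
rewrite big_ord_recr big_ord_recl /= wn !mul0r addr0 add0r.
apply: eq_bigr => b _; congr (_ * _%:R).
rewrite /= /bump/= add1n expnS [in RHS](mulnCA (k ^ a)%N) [in RHS](mulnCA i).
by rewrite dvdn_pmul2l.
Qed.

Lemma dilations_delta N n c i j D : spreading N -> (0 < D)%N ->
  (i < n)%N -> (j < n)%N -> (k ^ i * l ^ j %| D)%N ->
  N (mkseq (dilations n (fun a b => c a b * delta R i j a b) D) D) =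
  `|c i j| * N (nseq (k ^ i * l ^ j) 1).
Proof.
move=> spN D0 hi hj /dvdnP[E DE].
have dE r : dilations n (fun a b => c a b * delta R i j a b) D r =
    c i j * (D %| r * (k ^ i * l ^ j))%:R.
  rewrite /dilations (bigD1 (Ordinal hi))//= [X in _ + X]big1 => [|a ai]; last first.
    apply: big1 => b _; rewrite /delta [nat_of_ord a == _](negbTE ai).
    by rewrite mulr0 mul0r.
  rewrite addr0 (bigD1 (Ordinal hj))//= big1 => [|b bj]; last first.
    by rewrite /delta [nat_of_ord b == _](negbTE bj) andbF mulr0 mul0r.
  by rewrite /delta !eqxx mulr1 addr0.
have E0 : (0 < E)%N by move: D0; rewrite DE muln_gt0 => /andP[].
rewrite (eq_mkseq dE) -[mkseq _ _]cat0s -[mkseq _ _]cats0 {2}DE [(E * _)%N]mulnC mkseq_refine//.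
  rewrite cats0 /= -spreadingZ//; congr (N _); apply: (@eq_from_nth _ 0).
    by rewrite size_mkseq size_lscale size_nseq.
  move=> r; rewrite size_mkseq => hr; rewrite nth_mkseq// (nth_map 0) ?size_nseq//.
  by rewrite nth_nseq hr DE -mulnA dvdn_mull// dvdnn.
move=> r Er; rewrite DE [(r * _)%N]mulnC [(E * _)%N]mulnC dvdn_pmul2l//.
by rewrite (negbTE Er) mulr0.
Qed.

End Dilation.

End Dilations.

(** * Common approximate eigenvectors of two dilations *)

Section Eigenvectors.
Context (R : realType) (N : seq R -> R).
Hypotheses (spN : spreading N) (soN : solid N) (N1 : N [:: 1] = 1).

Lemma solid_mkseq n (f g : nat -> R) : (forall i, `|f i| <= g i) ->
  N (mkseq f n) <= N (mkseq g n).
Proof.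
move=> fg; apply: soN; first by rewrite !size_mkseq.
move=> i; have [ni|ni] := ltnP i n; last by rewrite !nth_default ?size_mkseq.
by rewrite !nth_mkseq// (le_trans (fg i))// ler_norm.
Qed.

Definition growth_bounds (a : R) := forall d : R, 0 < d ->
  (exists2 D, 0 < D & forall K, (0 < K)%N -> phi N K <= D * K%:R `^ (a + d)) /\
  (forall (B : nat) D, (1 < B)%N -> 0 < D ->
     exists m, D * (B%:R `^ (a - d)) ^+ m <= phi N (B ^ m)).

(* With l = k + 1, Krivine's approximate eigenvector of T_k and T_l is the sum of
   the w a b (k^a l^b)^(-alpha) T_(k^a l^b) e with w a tent: T_k and T_l shift w,
   and by the choice of alpha the norm of (k^a l^b)^(-alpha) T_(k^a l^b) e grows
   slower than any exponential. *)
Lemma dilation_eigenvector (alpha : R) k e : 0 <= alpha -> growth_bounds alpha ->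
  (0 < k)%N -> 0 < e ->
  exists2 u, 0 < N u & forall j, j \in [:: k; k.+1] -> forall s t c,
    N (s ++ kron (nseq j c) u ++ t) <=
      N (s ++ lscale (c * j%:R `^ alpha) u ++ t) + e * `|c| * N u /\
    N (s ++ lscale (c * j%:R `^ alpha) u ++ t) <=
      N (s ++ kron (nseq j c) u ++ t) + e * `|c| * N u.
Proof.
move=> alpha0 gN k0 e0; set l := k.+1; have l0 : (0 < l)%N by [].
pose B := (k * l)%N.
have B1 : (1 < B)%N by rewrite /B /l; case: (k) k0 => // k' _; lia.
have B0 : (0 < B)%N by exact: ltnW.
(* 3 eta is the error in [folner]; the factor 1 + l^alpha makes up for the eigenvalues k^alpha and
   l^alpha. *)
pose eta := e / (3 * (1 + l%:R `^ alpha)).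
have eta0 : 0 < eta.
  by rewrite divr_gt0// mulr_gt0// addr_gt0// powR_gt0// ltr0n.
have eta1 : 0 < 1 + eta by rewrite addr_gt0.
pose q := (1 + eta)^-1.
have lnB : 0 < ln (B%:R : R) by rewrite ln_gt0// ltr1n.
have lneta : 0 < ln (1 + eta) by rewrite ln_gt0// ltrDl.
(* With z = B^d this means z^6 = 1 + eta. Then q^m = z^(-6m) has to beat z^(2m) from the upper bound
   G, z^m from the lower bound for phi, and 2m+1 = O(z^m). *)
pose d := ln (1 + eta) / (6 * ln (B%:R : R)).
have d0 : 0 < d by rewrite divr_gt0// mulr_gt0.
pose z := (B%:R : R) `^ d.
have z0 : 0 < z by rewrite powR_gt0// ltr0n.
have z6 : z ^+ 6 = 1 + eta.
  rewrite -powR_mulrn ?(ltW z0)// -powRrM /d.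
  rewrite {1}/powR pnatr_eq0 -leqn0 leqNgt B0.
  have -> : ln (1 + eta) / (6 * ln (B%:R : R)) * 6 * ln B%:R = ln (1 + eta).
    by field; rewrite gt_eqF.
  by rewrite /= lnK// posrE.
have z1 : 1 < z by rewrite -(powRr0 (B%:R : R)) /z -ltr_ln ?posrE ?powR_gt0 ?ltr0n// !ln_powR mul0r mulr_gt0.
have [[D1 D10 hD1] hlow] := gN _ d0.
have z10 : 0 < z - 1 by rewrite subr_gt0.
have [C C0 hC] := linear_geometric z10.
have [|m hm] := hlow B (8 * D1 * z * C / eta) B1.
  by rewrite divr_gt0// !mulr_gt0.
have mm : (m <= m.*2.+1)%N by rewrite leqW// -addnn leq_addl.
pose n := m.*2.+1; pose D := (B ^ n.+1)%N.
have D0 : (0 < D)%N by rewrite expn_gt0 B0.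
have KD a b : (a < n.+1)%N -> (b < n.+1)%N -> (k ^ a * l ^ b %| D)%N.
  by move=> an bn; rewrite /D /B expnMn dvdn_mul// dvdn_exp2l// ltnW.
pose K a b := (k ^ a * l ^ b)%N.
have K0 a b : (0 < K a b)%N by rewrite muln_gt0 !expn_gt0 k0.
pose cf a b : R := (K a b)%:R `^ (- alpha).
have cf0 a b : 0 < cf a b by rewrite powR_gt0// ltr0n.
pose F w := N (mkseq (dilations k l n.+1 (fun a b => cf a b * w a b) D) D).
have Fdelta i j : (i <= m.*2.+1)%N -> (j <= m.*2.+1)%N ->
    F (delta R i j) = cf i j * phi N (K i j).
  move=> im jm; rewrite /F (dilations_delta k0 l0)//; last exact: KD.
  by rewrite gtr0_norm.
have cfE a b : cf a b = ((K a b)%:R `^ alpha)^-1 by rewrite /cf powRN.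
pose G := D1 * z ^+ m.*2.+1.
have [|||||FS1 FS2 Fmm] := @folner R eta q eta0 erefl F m G.
- move=> w w'; rewrite /F (le_trans _ (spreadingD spN _)) ?size_mkseq//.
  rewrite ladd_mkseq le_eqVlt; apply/orP; left; apply/eqP; congr (N _).
  apply: eq_mkseq => i; rewrite /dilations -big_split; apply: eq_bigr => a _.
  by rewrite -big_split; apply: eq_bigr => b _; rewrite mulrDr mulrDl.
- move=> c w; rewrite /F -spreadingZ// lscale_mkseq; congr (N _).
  apply: eq_mkseq => i; rewrite /dilations mulr_sumr; apply: eq_bigr => a _.
  by rewrite mulr_sumr; apply: eq_bigr => b _; rewrite !mulrA [_ * c]mulrC.
- move=> w w' ww'; apply: (@le_trans _ _ (F w')).
    apply: solid_mkseq => i; rewrite /dilations.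
    rewrite (le_trans (ler_norm_sum _ _ _))//; apply: ler_sum => a _.
    rewrite (le_trans (ler_norm_sum _ _ _))//; apply: ler_sum => b _.
    by rewrite !normrM gtr0_norm// [`|_%:R|]ger0_norm// ler_wpM2r// ler_wpM2l// ltW.
  by rewrite mulr_natl mulr2n lerDl spreading_ge0.
- move=> i j im jm; rewrite Fdelta// cfE.
  rewrite mulrC ler_pdivrMr ?powR_gt0 ?ltr0n//.
  rewrite (le_trans (hD1 _ (K0 i j)))// powRD; last first.
    by rewrite pnatr_eq0 -lt0n K0 implybT.
  rewrite mulrCA mulrC ler_wpM2r ?powR_ge0// /G ler_wpM2l ?(ltW D10)//.
  rewrite -powR_mulrn ?(ltW z0)// /z powRAC powR_mulrn ?ler0n// -natrX.
  rewrite ge0_ler_powR ?nnegrE ?(ltW d0)// ler_nat /K /B expnMn.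
  by rewrite leq_mul// leq_pexp2l.
- have Kmm : K m m = (B ^ m)%N by rewrite /K /B expnMn.
  rewrite Fdelta// cfE Kmm [leRHS]mulrCA [leRHS]mulrC ler_pdivlMr ?powR_gt0 ?ltr0n ?expn_gt0 ?B0//.
  apply: le_trans (ler_wpM2l (ltW eta0) hm).
  have -> : (B ^ m)%:R `^ alpha = ((B%:R : R) `^ alpha) ^+ m.
    by rewrite natrX -powR_mulrn ?ler0n// powRAC powR_mulrn// powR_ge0.
  rewrite powRB ?pnatr_eq0 -?lt0n ?B0 ?implybT// exprMn -/z exprVn.
  set y := (_ `^ alpha) ^+ m; have y0 : 0 <= y by rewrite exprn_ge0// powR_ge0.
  rewrite /q exprVn -z6 -exprM [(6 * m)%N]mulnC exprM /G.
  have zm0 : 0 < z ^+ m by exact: exprn_gt0.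
  have -> : z ^+ m.*2.+1 = z * (z ^+ m * z ^+ m) by rewrite exprS -addnn exprD.
  have := hC m; rewrite [1 + _]addrC subrK.
  have := exprn_ege1 m (ltW z1).
  move: (z ^+ m) zm0 => t t0 t1 ht.
  have e1 : 8 * D1 * z * C / eta * (y * t^-1) * eta = 8 * D1 * z * y * (C * t^-1).
    by field; rewrite !gt_eqF.
  rewrite [leRHS]mulrC e1.
  have -> : 8 * (m.*2.+1%:R * t ^- 6) * (D1 * (z * (t * t))) * y =
      8 * D1 * z * y * (m.*2.+1%:R * t ^- 4) by field; rewrite gt_eqF.
  apply: ler_wpM2l; first by rewrite !mulr_ge0 ?(ltW D10) ?(ltW z0).
  rewrite ler_pdivrMr ?exprn_gt0// (le_trans ht)// -mulrA ler_wpM2l ?(ltW C0)//.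
  by rewrite exprS mulKf ?gt_eqF// -[leLHS]expr1 ler_weXn2l.
pose v a b := cf a b * tent2 q m a b.
pose u := mkseq (dilations k l n.+1 v D) D.
have uE : N u = F (tent2 q m) by [].
have u0 : 0 < N u.
  rewrite uE -(pmulr_rgt0 _ (ltr0n R 2 : 0 < 2%:R)) (lt_le_trans _ Fmm)//.
  rewrite Fdelta ?mulr_gt0//.
  by rewrite (lt_le_trans ltr01)// phi_ge1.
exists u => //.
(* Both dilations at once: j copies of u are u with weights shifted by [sh], and the factors [cf]
   turn the shift into multiplication by j^alpha. *)
have main j (sh : (nat -> nat -> R) -> nat -> nat -> R) : (0 < j)%N -> (j <= l)%N ->
    flatten (nseq j u) = mkseq (dilations k l n.+1 (sh v) (j * D)) (j * D) ->
    (forall a b, sh v a b = j%:R `^ alpha * (cf a b * sh (tent2 q m) a b)) ->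
    F (fun a b => sh (tent2 q m) a b - tent2 q m a b) <= 3 * eta * F (tent2 q m) ->
  forall s t c,
    N (s ++ kron (nseq j c) u ++ t) <=
      N (s ++ lscale (c * j%:R `^ alpha) u ++ t) + e * `|c| * N u /\
    N (s ++ lscale (c * j%:R `^ alpha) u ++ t) <=
      N (s ++ kron (nseq j c) u ++ t) + e * `|c| * N u.
  move=> j0 jl uj shv FS s t c.
  pose x := lscale c (flatten (nseq j u)).
  (* u is sampled again at the multiples of 1/(D j), to get the same length as j copies of u. *)
  pose y := lscale (c * j%:R `^ alpha) (mkseq (dilations k l n.+1 v (D * j)) (D * j)).
  have -> : kron (nseq j c) u = x.
    rewrite kron_nseq /x; elim: (j) => //= j' ->.
    by rewrite [in RHS]lscale_cat.
  rewrite -(@dilations_refine R k l k0 l0 N n.+1 v D j s t _ spN j0 D0 KD) -/y.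
  have xy : size x = size y by rewrite /x uj !size_lscale !size_mkseq mulnC.
  have dN : N (ladd x (lscale (-1) y)) <= e * `|c| * N u.
    have -> : ladd x (lscale (-1) y) = lscale (c * j%:R `^ alpha) (mkseq
        (dilations k l n.+1 (fun a b => cf a b * (sh (tent2 q m) a b - tent2 q m a b)) (D * j)) (D * j)).
      rewrite /x /y uj [(j * D)%N]mulnC !lscale_mkseq ladd_mkseq; apply: eq_mkseq => i.
      rewrite mulN1r -mulNr !mulr_sumr -big_split; apply: eq_bigr => a _.
      rewrite !mulr_sumr -big_split; apply: eq_bigr => b _ /=.
      by rewrite shv /v; ring.
    rewrite spreadingZ// normrM.
    have := @dilations_refine R k l k0 l0 N n.+1 (fun a b => cf a b *
      (sh (tent2 q m) a b - tent2 q m a b)) D j [::] [::] 1 spN j0 D0 KD.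
    rewrite /= !cats0 !lscale1 => ->; rewrite -/(F _).
    rewrite -[leLHS]mulrA [e * `|c|]mulrC -[leRHS]mulrA ler_wpM2l// uE gtr0_norm ?powR_gt0 ?ltr0n//.
    rewrite (le_trans (ler_wpM2l (powR_ge0 _ _) FS))// mulrA ler_wpM2r//.
      by rewrite -uE ltW.
    have jl' : j%:R `^ alpha <= 1 + l%:R `^ alpha.
      by rewrite (@le_trans _ _ (l%:R `^ alpha)) ?lerDr// ge0_ler_powR ?nnegrE// ler_nat.
    have L0 : 0 < 1 + (l%:R : R) `^ alpha by rewrite addr_gt0// powR_gt0// ltr0n.
    have -> : 3 * eta = e / (1 + l%:R `^ alpha) by rewrite /eta; field; rewrite gt_eqF.
    by rewrite mulrCA ler_piMr ?(ltW e0)// ler_pdivrMr// mul1r.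
  split; first by rewrite (le_trans (spreading_swap spN _ _ xy))// lerD2l.
  rewrite (le_trans (spreading_swap spN _ _ (esym xy)))// lerD2l.
  by rewrite spreading_distC.
have tn b : tent2 q m n b = 0 by rewrite /tent2 {1}/tent ltnn mul0r.
have tn' a : tent2 q m a n = 0 by rewrite /tent2 {2}/tent ltnn mulr0.
have pw j (M : nat) : (0 < j)%N ->
    (M%:R : R) `^ (- alpha) = j%:R `^ alpha * (j * M)%N%:R `^ (- alpha).
  move=> j0; rewrite natrM powRM ?ler0n// mulrA -powRD ?subrr ?powRr0 ?mul1r//.
  by rewrite pnatr_eq0 -lt0n j0 implybT.
have cfS1 a b : cf a b = k%:R `^ alpha * cf a.+1 b.
  by rewrite /cf (pw k)// /K expnS mulnA.
have cfS2 a b : cf a b = l%:R `^ alpha * cf a b.+1.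
  by rewrite /cf (pw l)// /K expnS mulnCA.
move=> j; rewrite !inE => /orP[/eqP ->|/eqP ->].
  apply: (main k (@shift1 R)) => //.
  - by apply: dilations_copies1 => // b; rewrite /v tn mulr0.
  - case=> [|a] b /=; first by rewrite !mulr0.
    by rewrite /v cfS1 mulrA.
apply: (main l (@shift2 R)) => //.
- by apply: dilations_copies2 => // b; rewrite /v tn' mulr0.
- move=> a [|b] /=; first by rewrite !mulr0.
  by rewrite /v cfS2 mulrA.
Qed.

End Eigenvectors.

Section Krivine.
Context (R : realType) (X : normedModType R) (N0 : seq R -> R).
Hypotheses (spN0 : spreading N0) (soN0 : solid N0) (mN0 : modeled X N0)
  (N01 : N0 [:: 1] = 1).

Lemma solid_kron u : solid (fun s => N0 (kron s u)).
Proof.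
move=> s t st h; apply: soN0; first by rewrite !size_kron st.
by move=> i; rewrite !nth_kron !normrM ler_wpM2r.
Qed.

(** The errors of [dilation_eigenvector] are proportional to the norm of the block, hence they tend
    to 0 after normalisation and disappear in the ultralimit. *)
Lemma dilation_invariant (alpha : R) k : 0 <= alpha -> growth_bounds N0 alpha ->
  (0 < k)%N -> exists N, [/\ spreading N, solid N, modeled X N, N [:: 1] = 1 &
    forall j, j \in [:: k; k.+1] -> forall s t c,
      N (s ++ nseq j c ++ t) = N (s ++ c * j%:R `^ alpha :: t)].
Proof.
move=> alpha0 gN k0.
have /choice[u hu] : forall m : nat, exists u, 0 < N0 u /\
    forall j, j \in [:: k; k.+1] -> forall s t c,
    N0 (s ++ kron (nseq j c) u ++ t) <=
      N0 (s ++ lscale (c * j%:R `^ alpha) u ++ t) + m.+1%:R^-1 * `|c| * N0 u /\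
    N0 (s ++ lscale (c * j%:R `^ alpha) u ++ t) <=
      N0 (s ++ kron (nseq j c) u ++ t) + m.+1%:R^-1 * `|c| * N0 u.
  move=> m.
  have [u u0 h] := dilation_eigenvector (e := m.+1%:R^-1) spN0 soN0 N01 alpha0 gN k0
    (ltac:(by [])).
  by exists u.
have [|N [spN mN NE NN]] := @ultralimit R X (fun m s => N0 (kron s (u m)) / N0 (u m)).
  move=> m; have [u0 _] := hu m; split.
  - by apply: (@spreading_scale _ (fun s => N0 (kron s (u m)))) (ltW u0); exact: spreading_kron.
  - apply: (@modeled_scale _ _ (fun s => N0 (kron s (u m)))) => //.
    exact: modeled_kron.
  - by rewrite /kron/= cats0 lscale1 divff// gt_eqF.
have small (c e : R) : 0 < e -> \forall m \near \oo, m.+1%:R^-1 * `|c| <= e :> R.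
  move=> e0; have c1 : 0 < `|c| + 1 by rewrite ltr_wpDl.
  have := @near_infty_natSinv_lt R (PosNum (divr_gt0 e0 c1)).
  apply: filterS => m /=; rewrite ltr_pdivlMr// => /ltW h.
  by rewrite (le_trans _ h)// ler_wpM2l// lerDl.
exists N; split => //.
  move=> s t st h; apply: NN => e e0; apply: nearW => m; have [u0 _] := hu m.
  rewrite (@le_trans _ _ (N0 (kron t (u m)) / N0 (u m))) ?lerDl ?(ltW e0)//.
  by rewrite ler_wpM2r ?invr_ge0 ?(ltW u0)//; exact: solid_kron.
move=> j jk s t c; apply: le_anti; apply/andP; split; apply: NN => e e0;
    apply: filterS (small c e e0) => m me; have [u0 /(_ j jk)/(_ _ _ _)h] := hu m;
    rewrite -lerBlDl -mulrBl ler_pdivrMr// lerBlDl !kron_cat kron_cons.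
  have [h1 _] := h (kron s (u m)) (kron t (u m)) c; rewrite (le_trans h1)// lerD2l.
  by rewrite ler_wpM2r// ltW.
have [_ h2] := h (kron s (u m)) (kron t (u m)) c; rewrite (le_trans h2)// lerD2l.
by rewrite ler_wpM2r// ltW.
Qed.

End Krivine.

(** * Almost invariance under permutations *)

Section Symmetry.
Context (R : realType) (N : seq R -> R).
Hypotheses (spN : spreading N) (soN : solid N) (N1 : N [:: 1] = 1).
Context (alpha : R) (k : nat).
Hypotheses (k0 : (0 < k)%N)
  (Nk : forall j, j \in [:: k; k.+1] -> forall s t c,
      N (s ++ nseq j c ++ t) = N (s ++ c * j%:R `^ alpha :: t)).

Let good K := forall s t c, N (s ++ nseq K c ++ t) = N (s ++ c * K%:R `^ alpha :: t).

Let good1 : good 1.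
Proof. by move=> s t c; rewrite powR1 mulr1. Qed.

Let goodM K j : j \in [:: k; k.+1] -> good K -> good (j * K).
Proof.
move=> jk gK s t c; rewrite natrM powRM ?ler0n// mulrCA -[_ * _]mulrC -Nk//.
rewrite -[X in _ = N (s ++ nseq X _ ++ _)]muln1 => //.
elim: (j) s => [|i IH] s; first by [].
by rewrite mulSn nseqD -catA gK -cat_rcons IH /= cat_rcons.
Qed.

Let good_grid a b : good (k.+1 ^ a * k ^ b).
Proof.
elim: a => [|a IH]; last by rewrite expnS -mulnA; apply: goodM => //; rewrite !inE eqxx orbT.
rewrite expn0 mul1n; elim: b => [|b IH]; first exact: good1.
by rewrite expnS; apply: goodM => //; rewrite !inE eqxx.
Qed.

Lemma grid_norm (Ks : seq (nat * nat)) c s :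
  N (s ++ [seq c * (k.+1 ^ p.1 * k ^ p.2)%N%:R `^ alpha | p <- Ks]) =
  N (s ++ nseq (\sum_(p <- Ks) k.+1 ^ p.1 * k ^ p.2) c).
Proof.
elim: Ks s => [|p Ks IH] s; first by rewrite big_nil.
by rewrite /= -good_grid catA IH -catA -nseqD big_cons.
Qed.

Lemma solid_sub s a t : `|a| <= N (s ++ a :: t).
Proof.
have -> : `|a| = N (nseq (size s) 0 ++ [:: a] ++ nseq (size t) 0).
  rewrite (spreading_pad spN _ _ _ 0).1 (_ : [:: a] = lscale a [:: 1]).
    by rewrite spreadingZ// N1 mulr1.
  by rewrite /lscale/= mulr1.
apply: soN; first by rewrite !size_cat !size_nseq.
move=> i; rewrite !nth_cat size_nseq nth_nseq; case: ltnP => _.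
  by rewrite normr0.
by case: (i - size s)%N => //= j; rewrite nth_nseq if_same normr0.
Qed.

Lemma solid_abs s : N [seq `|x| | x <- s] = N s.
Proof.
have h i : `|[seq `|x| | x <- s]`_i| = `|s`_i|.
  have [si|si] := ltnP i (size s); first by rewrite (nth_map 0)// normr_id.
  by rewrite !nth_default ?size_map.
by apply: le_anti; rewrite !soN ?size_map// => i; rewrite h.
Qed.

Lemma spreading_filter0 s : N [seq x <- s | x != 0] = N s.
Proof.
suff h t : N (t ++ [seq x <- s | x != 0]) = N (t ++ s) by exact: (h [::]).
elim: s t => [|a s IH] t //=; case: eqP => [->|_] /=; first by rewrite IH spreading0.
by rewrite -cat_rcons IH cat_rcons.
Qed.

(** For alpha = 0, k copies of c have norm |c|. So N s is at most |b|, where b is an entry of s of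
    largest modulus; and b occurs in t, whence |b| <= N t. *)
Lemma almost_symmetric_max s t : alpha = 0 -> (size s <= k)%N -> perm_eq s t ->
  N s <= N t.
Proof.
move=> a0 sk st.
have Nc c : N (nseq k c) = `|c|.
  have := Nk (mem_head k _) [::] [::] c; rewrite cats0 /= => ->.
  by rewrite a0 powRr0 mulr1 -[RHS]mulr1 -N1 -spreadingZ// /lscale/= mulr1.
case: s sk st => [|a s] sk st; first by rewrite (spreading_nil spN) spreading_ge0.
have [b bs hb] : exists2 b, b \in a :: s & forall c, c \in a :: s -> `|c| <= `|b|.
  elim: (s) => [|c r [b br hb]].
    by exists a => [|c]; rewrite ?mem_head// inE => /eqP ->.
  have sub : {subset a :: r <= [:: a, c & r]}.
    by move=> x; rewrite !inE => /orP[->//|->]; rewrite !orbT.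
  have [cb|bc] := leP `|c| `|b|.
    exists b => [|x]; first exact: sub.
    rewrite !inE => /or3P[/eqP ->|/eqP -> //|xr]; apply: hb; rewrite !inE ?eqxx//.
    by rewrite xr orbT.
  exists c => [|x]; first by rewrite !inE eqxx orbT.
  rewrite !inE => /or3P[/eqP ->|/eqP -> //|xr]; rewrite (le_trans _ (ltW bc))// hb//.
    by rewrite mem_head.
  by rewrite inE xr orbT.
have : b \in t by rewrite -(perm_mem st).
move=> /path.splitPr[t1 t2]; apply: le_trans (solid_sub _ _ _).
rewrite -Nc -(spreading_cat0 spN (k - size (a :: s)) (a :: s)).
apply: soN; first by rewrite size_cat !size_nseq subnKC.
move=> i; rewrite nth_cat [nth 0 (nseq k b) i]nth_nseq; case: ltnP => si.
  by rewrite (leq_trans si sk) hb// mem_nth.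
by rewrite nth_nseq if_same normr0.
Qed.

(* Up to the factor 1 + 1/k the entries are on the grid c ((k+1)^a k^b)^alpha,
   where N depends only on the sum of the (k+1)^a k^b. *)
Lemma almost_symmetric_pos s t : 0 < alpha <= 1 -> perm_eq s t ->
  N s <= (1 + k%:R^-1) * N t.
Proof.
(* Zeros and signs do not change N, so all entries may be taken positive. *)
move=> /andP[a0 a1] st; have kR : 0 < k%:R :> R by rewrite ltr0n.
pose f (s : seq R) := [seq x <- [seq `|x| | x <- s] | x != 0 :> R].
have fN r : N (f r) = N r by rewrite spreading_filter0 solid_abs.
have {st} st : perm_eq (f s) (f t) by apply/perm_filter/perm_map.
rewrite -(fN s) -(fN t).
have : forall x, x \in f s -> 0 < x.
  by move=> x; rewrite mem_filter => /andP[x0 /mapP[y _ yE]]; rewrite lt_def x0 yE normr_ge0.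
move: (f s) (f t) st => {}s {}t st s0.
pose rho := (1 + k%:R^-1 : R) `^ alpha.
have rho1 : 1 < rho.
  rewrite -(powRr0 (1 + k%:R^-1 : R)) /rho -ltr_ln ?posrE ?powR_gt0 ?addr_gt0 ?invr_gt0//.
  by rewrite !ln_powR mul0r mulr_gt0// ln_gt0// ltrDl invr_gt0.
have rho0 : 0 < rho by rewrite (lt_trans ltr01).
have [b b0 hb] : exists2 b : R, 0 < b & forall x, x \in s -> b <= x.
  elim: (s) s0 => [|x r IH] s0; first by exists 1.
  have [|b b0 hb] := IH; first by move=> y yr; rewrite s0// inE yr orbT.
  exists (Num.min b x); first by rewrite lt_min b0 s0// mem_head.
  by move=> y; rewrite inE ge_min => /orP[/eqP ->|/hb ->]; rewrite ?lexx ?orbT.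
have /choice[j hj] : forall x, exists j : nat, b <= x -> b * rho ^+ j <= x <= b * rho ^+ j.+1.
  move=> x; case: (pselect (b <= x)) => [bx|nbx]; last by exists 0%N.
  have [m hm] : exists m, x <= b * rho ^+ m.
    have [m hm] : exists m : nat, x / b / (rho - 1) < m%:R.
      by exists (Num.truncn (x / b / (rho - 1))).+1; rewrite truncnS_gt.
    exists m; rewrite mulrC -ler_pdivrMr//.
    have r1 : 0 < rho - 1 by rewrite subr_gt0.
    have := bernoulli_ineq m (ltW r1); rewrite [1 + (rho - 1)]addrC subrK.
    apply: le_trans; move: hm; rewrite ltr_pdivrMr// => /ltW h.
    by rewrite (le_trans h)// lerDr.
  have [m' hm' mmin] := ex_minnP (ex_intro (fun m => x <= b * rho ^+ m) m hm).
  exists m'.-1 => _; case: m' hm' mmin => [|m'] hm' mmin /=.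
    move: hm'; rewrite expr0 expr1 mulr1 => xb; rewrite bx /= (le_trans xb)//.
    by rewrite ler_peMr ?ltW.
  rewrite hm' andbT leNgt; apply/negP => /ltW/mmin; by rewrite ltnn.
(* As rho = ((k+1)/k)^alpha, b rho^i = c ((k+1)^i k^(J-i))^alpha for c = b / k^(alpha J); J is large
   enough for all the exponents J - i to be natural numbers. Each entry is rounded up to such a
   value. *)
pose J := (\max_(x <- s) (j x).+1)%N.
pose c := b / (k%:R `^ alpha) ^+ J.
pose g x := b * rho ^+ (j x).+1.
pose p x := ((j x).+1, (J - (j x).+1)%N).
have kal0 : 0 < (k%:R : R) `^ alpha by exact: powR_gt0.
have rhoE : rho = (k.+1%:R : R) `^ alpha / k%:R `^ alpha.
  have <- : rho * k%:R `^ alpha = k.+1%:R `^ alpha.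
    rewrite -powRM ?addr_ge0 ?invr_ge0//; congr (_ `^ _).
    by rewrite mulrDl mul1r mulVf ?gt_eqF// natr1.
  by rewrite mulfK// gt_eqF.
have gE x : x \in s -> g x = c * (k.+1 ^ (p x).1 * k ^ (p x).2)%N%:R `^ alpha.
  move=> xs.
  have jJ : ((j x).+1 <= J)%N by exact: (@leq_bigmax_seq _ s xpredT (fun x => (j x).+1)).
  have pX i m : (i ^ m)%N%:R `^ alpha = ((i%:R : R) `^ alpha) ^+ m.
    by rewrite natrX -powR_mulrn ?ler0n// powRAC powR_mulrn// powR_ge0.
  rewrite /g /c /p /= natrM powRM ?ler0n// !pX rhoE expr_div_n.
  have -> : (k%:R : R) `^ alpha ^+ J =
      k%:R `^ alpha ^+ (J - (j x).+1) * k%:R `^ alpha ^+ (j x).+1.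
    by rewrite -exprD subnK.
  have nz m : (k%:R : R) `^ alpha ^+ m != 0 by rewrite expf_neq0// gt_eqF.
  by field; rewrite !nz.
have gN (r : seq R) : {subset r <= s} ->
    N (map g r) = N (nseq (\sum_(x <- r) (k.+1 ^ (p x).1 * k ^ (p x).2))%N c).
  move=> rs; rewrite -(big_map p xpredT (fun p => k.+1 ^ p.1 * k ^ p.2)%N).
  rewrite -[nseq _ _]cat0s -grid_norm /= -map_comp; congr (N _).
  by apply/eq_in_map => x xr; rewrite gE//; exact: rs.
have bg x : x \in s -> 0 <= x <= g x /\ g x <= rho * x.
  move=> xs; have /andP[h1 h2] := hj x (hb x xs); split.
    by rewrite h2 ltW// s0.
  by rewrite /g exprS mulrCA ler_wpM2l// ltW.
have ts : {subset t <= s} by move=> x; rewrite (perm_mem st).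
apply: (@le_trans _ _ (N (map g s))).
  apply: soN; first by rewrite size_map.
  move=> i; have [si|si] := ltnP i (size s); last by rewrite !nth_default ?size_map.
  rewrite (nth_map 0)//; have [/andP[h1 h2] _] := bg _ (mem_nth 0 si).
  by rewrite !ger0_norm// (le_trans h1).
rewrite gN// (perm_big _ st) /= -gN//.
apply: (@le_trans _ _ (N (lscale rho t))).
  apply: soN; first by rewrite !size_map.
  move=> i; have [ti|ti] := ltnP i (size t); last by rewrite !nth_default ?size_map.
  rewrite !(nth_map 0)//; have [/andP[h1 h2] h3] := bg _ (ts _ (mem_nth 0 ti)).
  have h4 := le_trans h1 h2.
  by rewrite (ger0_norm h4) (ger0_norm (le_trans h4 h3)).
rewrite spreadingZ// gtr0_norm// ler_wpM2r ?spreading_ge0//.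
by rewrite /rho ler1_powR// lerDl invr_ge0.
Qed.

End Symmetry.

Lemma exists_symmetric_model (R : realType) (X : completeNormedModType R) n (e : R) :
  infinite_dimensional X -> 0 < e ->
  exists N, [/\ spreading N, solid N, modeled X N, N [:: 1] = 1 &
    forall s t, (size s <= n)%N -> perm_eq s t -> N s <= (1 + e) * N t].
Proof.
move=> Xinf e0; have [N0 [spN0 soN0 mN0 N01]] := exists_solid_model Xinf.
have [al /andP[al0 al1] gN] := growth_exponent spN0 soN0 N01.
have [K hK] : exists K : nat, e^-1 < K%:R.
  by exists (Num.truncn e^-1).+1; rewrite truncnS_gt.
(* k >= n serves the case alpha = 0, and k >= 1/e the case alpha > 0. *)
pose k := maxn n (maxn K 1).
have k0 : (0 < k)%N by rewrite !leq_max/= !orbT.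
have [N [spN soN mN N1 Nk]] := dilation_invariant spN0 soN0 mN0 N01 al0 gN k0.
exists N; split => // s t sn st.
have [a0|a0] := eqVneq al 0.
  apply: (@le_trans _ _ (N t)).
    exact: (almost_symmetric_max spN soN N1 Nk a0 (leq_trans sn (leq_maxl _ _)) st).
  by rewrite ler_peMl ?spreading_ge0// lerDl ltW.
have al01 : 0 < al <= 1 by rewrite lt_def a0 al0.
apply: (@le_trans _ _ ((1 + k%:R^-1) * N t)).
  exact: (almost_symmetric_pos spN soN k0 Nk al01 st).
rewrite ler_wpM2r ?spreading_ge0// lerD2l.
rewrite -(invrK e) lef_pV2 ?posrE ?invr_gt0 ?ltr0n//.
by rewrite (le_trans (ltW hK))// ler_nat !leq_max leqnn orbT.
Qed.

(** * Dvoretzky's theorem *)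

Section Hall.
Import fintype finset.
Local Open Scope set_scope.
Context (T : finType) (r : rel T).

Definition neighbors (S : {set T}) := [set b | [exists a in S, r a b]].

Lemma mem_neighbors (S : {set T}) a b : a \in S -> r a b -> b \in neighbors S.
Proof. by move=> aS ab; rewrite inE; apply/existsP; exists a; rewrite aS. Qed.

(** Induction on #|D|, C being the set of values still allowed. If every proper nonempty S has a
    neighbor to spare, any pair a, b can be matched and removed. Otherwise a tight S0 is matched
    first, and the rest avoids the neighbors of S0. *)
Let hall_in n (D C : {set T}) : #|D| = n ->
  (forall S : {set T}, S \subset D -> #|S| <= #|neighbors S :&: C|)%N ->
  exists f : T -> T, {in D &, injective f} /\
    forall a, a \in D -> (f a \in C) && r a (f a).
Proof.
have [m] := ubnP n; elim: m n D C => // m IH n D C nm Dn hD.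
have [D0|[a aD]] := set_0Vmem D.
  by exists id; split => [x y _ _ //|x]; rewrite D0 inE.
case: (boolP [forall S : {set T},
    [&& S != finset.set0, S \subset D & S != D] ==> (#|S| < #|neighbors S :&: C|)%N]).
  move=> /forallP hS.
  have /card_gt0P[b] : (0 < #|neighbors [set a] :&: C|)%N.
    by apply: leq_trans (hD _ _); rewrite ?cards1// finset.sub1set.
  rewrite !inE => /andP[/existsP[a' /andP[/set1P -> ab]] bC].
  have Dam : (#|D :\ a| < m)%N.
    by rewrite -ltnS (leq_trans _ nm)// ltnS -Dn [#|D|](cardsD1 a) aD.
  have [|f [finj fC]] := IH _ (D :\ a) (C :\ b) Dam erefl.
    move=> S SD; have [->|S0] := eqVneq S finset.set0; first by rewrite cards0.
    have SsD : S \subset D by rewrite (fintype.subset_trans SD)// subD1set.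
    have SnD : S != D.
      apply/eqP => SE; move: SD; rewrite SE => /subsetP/(_ a aD).
      by rewrite !inE eqxx.
    have := hS S; rewrite S0 SsD SnD /= => h.
    rewrite -ltnS (leq_trans h)// finset.setIDA (cardsD1 b (neighbors S :&: C)).
    by case: (b \in _); rewrite ?add0n ?add1n.
  exists (fun x => if x == a then b else f x); split => [x y xD yD|x xD].
    case: (eqVneq x a) => [->|xa]; case: (eqVneq y a) => [->|ya] //.
    - have /andP[+ _] := fC y ltac:(by rewrite !inE ya yD).
      by rewrite !inE => /andP[fb _] bf; rewrite -bf eqxx in fb.
    - have /andP[+ _] := fC x ltac:(by rewrite !inE xa xD).
      by rewrite !inE => /andP[fb _] bf; rewrite bf eqxx in fb.
    - by apply: finj; rewrite !inE ?xa ?ya.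
  case: (eqVneq x a) => [->|xa]; first by rewrite bC.
  have := fC x ltac:(by rewrite !inE xa xD).
  by rewrite !inE -andbA => /andP[_].
move=> /forallPn[S0]; rewrite negb_imply -leqNgt => /andP[/and3P[S00 S0D S0nD] S0c].
have S0n : (#|S0| < #|D|)%N.
  by rewrite proper_card// finset.properEneq S0nD.
have S0m : (#|S0| < m)%N by rewrite (leq_trans S0n)// -ltnS Dn.
have [|f1 [f1inj f1C]] := IH _ S0 C S0m erefl.
  by move=> S SS0; apply: hD; exact: fintype.subset_trans S0D.
have DSn : (#|D :\: S0| < #|D|)%N.
  by rewrite cardsDS// ltn_subrL card_gt0 S00 (leq_trans _ S0n).
have DSm : (#|D :\: S0| < m)%N by rewrite (leq_trans DSn)// -ltnS Dn.
have [|f2 [f2inj f2C]] := IH _ (D :\: S0) (C :\: neighbors S0) DSm erefl.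
  (* Subtract the equality for the tight S0 from the condition for the union of S and S0. *)
  move=> S SD; rewrite -(leq_add2r #|S0|).
  have dis : S :&: S0 = finset.set0.
    apply/finset.setP => x; rewrite !finset.inE; apply/negbTE/negP => /andP[xS xS0].
    by move/subsetP: SD => /(_ x xS); rewrite finset.inE xS0.
  rewrite -cardsUI dis cards0 addn0.
  rewrite (leq_trans (hD _ _))//.
    by rewrite finset.subUset S0D (fintype.subset_trans SD) ?finset.subsetDl.
  rewrite (leq_trans _ (leq_add (leqnn _) S0c))//.
  rewrite (leq_trans _ (leq_card_setU _ _))// subset_leq_card//.
  apply/subsetP => b; rewrite !inE => /andP[/existsP[x /andP[]]].
  rewrite inE => xSS0 xb bC; rewrite bC /= !andbT.
  case: (boolP [exists a0 in S0, r a0 b]) => [_|h]; first by rewrite orbT.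
  rewrite orbF andbT; apply/existsP; exists x; rewrite xb andbT.
  case/orP: xSS0 => // xS0; case/negP: h; apply/existsP; exists x; by rewrite xS0.
exists (fun x => if x \in S0 then f1 x else f2 x); split => [x y xD yD|x xD].
  have h z w : z \in S0 -> w \in D -> w \notin S0 -> f1 z != f2 w.
    move=> zS wD wS; apply/negP => /eqP zw.
    have /andP[_ zr] := f1C z zS.
    have /andP[+ _] := f2C w ltac:(by rewrite inE wS).
    by rewrite inE -zw (mem_neighbors zS zr).
  case: ifP => xS; case: ifP => yS.
  - exact: f1inj.
  - by move=> e; have := h _ _ xS yD (negbT yS); rewrite e eqxx.
  - by move=> e; have := h _ _ yS xD (negbT xS); rewrite e eqxx.
  - by apply: f2inj; rewrite !inE ?xS ?yS.
case: ifP => xS; first exact: f1C.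
by have := f2C x ltac:(by rewrite inE xS); rewrite inE -andbA => /andP[_].
Qed.

Lemma hall : (forall S : {set T}, #|S| <= #|neighbors S|)%N ->
  exists f : T -> T, injective f /\ forall a, r a (f a).
Proof.
move=> h; have [|f [finj fr]] := @hall_in _ finset.setT finset.setT erefl.
  by move=> S _; rewrite finset.setIT.
by exists f; split => [x y|a]; [apply: finj|have /andP[] := fr a (finset.in_setT a)].
Qed.

End Hall.

(** * Reflections and nets of the sphere *)

Section Sphere.
Context (R : realType) (n : nat).
Local Notation V := 'rV[R]_n.+1.
Implicit Types (x y z : V).

Definition dot x y := \sum_i x 0 i * y 0 i.
(** The square of the distance, so as to avoid roots; the triangle inequality takes the form
    [dist2_le]. *)
Definition dist2 x y := dot (x - y) (x - y).

Lemma dotC x y : dot x y = dot y x.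
Proof. by apply: eq_bigr => i _; rewrite mulrC. Qed.

Lemma dotDl x y z : dot (x + y) z = dot x z + dot y z.
Proof. by rewrite -big_split; apply: eq_bigr => i _; rewrite mxE mulrDl. Qed.

Lemma dotZl a x y : dot (a *: x) y = a * dot x y.
Proof. by rewrite mulr_sumr; apply: eq_bigr => i _; rewrite mxE mulrA. Qed.

Lemma dotNl x y : dot (- x) y = - dot x y.
Proof. by rewrite -scaleN1r dotZl mulN1r. Qed.

Lemma dotBl x y z : dot (x - y) z = dot x z - dot y z.
Proof. by rewrite dotDl dotNl. Qed.

Lemma dotBr x y z : dot x (y - z) = dot x y - dot x z.
Proof. by rewrite dotC dotBl !(dotC x). Qed.

Lemma dotZr a x y : dot x (a *: y) = a * dot x y.
Proof. by rewrite dotC dotZl dotC. Qed.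

Lemma dot_ge0 x : 0 <= dot x x.
Proof. by apply: sumr_ge0 => i _; rewrite -expr2 sqr_ge0. Qed.

Lemma dot_eq0 x : dot x x = 0 -> x = 0.
Proof.
move=> /eqP; rewrite psumr_eq0 => [/allP h|i _]; last by rewrite -expr2 sqr_ge0.
apply/rowP => i; rewrite mxE; have /implyP/(_ isT) := h i (mem_index_enum _).
by rewrite -expr2 sqrf_eq0 => /eqP.
Qed.

Lemma dot_unit_le x y : dot x x = 1 -> dot x y ^+ 2 <= dot y y.
Proof.
move=> x1; rewrite -subr_ge0.
have := dot_ge0 (y - dot x y *: x).
rewrite !(dotBl, dotBr, dotZl, dotZr) x1 (dotC y x).
by congr (_ <= _); ring.
Qed.

Lemma dist2_le x y z : dist2 x z <= 2 * dist2 x y + 2 * dist2 y z.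
Proof.
rewrite -subr_ge0; have := dot_ge0 ((x - y) - (y - z)).
congr (_ <= _); rewrite /dist2 !(dotBl, dotBr) !(dotC _ x) !(dotC z y); ring.
Qed.

Lemma dist2C x y : dist2 x y = dist2 y x.
Proof. by rewrite /dist2 -opprB dotNl dotC dotNl opprK. Qed.

(** The reflection in the hyperplane orthogonal to w, and the identity for w = 0; thus
    [reflection (a - b)] makes sense also for a = b. *)
Definition reflection w x := x - (2 * (dot w x / dot w w)) *: w.

Lemma reflection_dot w x y : dot (reflection w x) (reflection w y) = dot x y.
Proof.
have [w0|w0] := eqVneq (dot w w) 0.
  by rewrite /reflection (dot_eq0 w0) !scaler0 !subr0.
rewrite /reflection !(dotBl, dotBr, dotZl, dotZr) !(dotC _ w).
by field.
Qed.

Lemma reflectionB w x y : reflection w x - reflection w y = reflection w (x - y).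
Proof.
rewrite /reflection dotBr mulrBl mulrBr scalerBl.
by rewrite !opprB addrACA [in RHS]addrACA; congr (_ + _); rewrite addrC.
Qed.

Lemma reflection_dist w x y : dist2 (reflection w x) (reflection w y) = dist2 x y.
Proof. by rewrite /dist2 reflectionB reflection_dot. Qed.

Lemma reflectionK w x : reflection w (reflection w x) = x.
Proof.
have [w0|w0] := eqVneq (dot w w) 0.
  by rewrite /reflection (dot_eq0 w0) !scaler0 !subr0.
rewrite /reflection !(dotBr, dotZr) -[RHS]addr0 -addrA; congr (_ + _).
rewrite -opprD -scalerDl [X in X *: _](_ : _ = 0) ?scale0r ?oppr0//.
by field.
Qed.

Lemma reflection_swap a b : dot a a = dot b b -> reflection (a - b) a = b.
Proof.
move=> ab; have [w0|w0] := eqVneq (dot (a - b) (a - b)) 0.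
  by rewrite /reflection (dot_eq0 w0) scaler0 subr0; apply/eqP; rewrite -subr_eq0 (dot_eq0 w0).
rewrite /reflection [2 * _](_ : _ = 1); first by rewrite scale1r opprB addrC subrK.
have e : dot (a - b) (a - b) = 2 * dot (a - b) a.
  by rewrite !(dotBl, dotBr) -ab (dotC b a); ring.
rewrite e; rewrite e in w0; field.
by move: w0; rewrite mulf_eq0 negb_or => /andP[].
Qed.

Definition sphere_net (d : R) (s : seq V) :=
  (forall x, x \in s -> dot x x = 1) /\
  forall y, dot y y = 1 -> exists2 x, x \in s & dist2 x y <= d.

(** Cut the coordinates into intervals of length 1/m and choose a point of the sphere in every cell
    that meets it. Two points of one cell have squared distance at most (n+1)/m^2. The other cells
    receive a basis vector. *)
Lemma exists_sphere_net d : 0 < d -> exists s, sphere_net d s.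
Proof.
move=> d0.
have [m m0 hm] : exists2 m : nat, (0 < m)%N & n.+1%:R / m%:R ^+ 2 <= d :> R.
  pose m := (Num.truncn (n.+1%:R / d)).+1; exists m => //.
  have md : n.+1%:R / d < m%:R by exact: truncnS_gt.
  rewrite ler_pdivrMr ?exprn_gt0 ?ltr0n// mulrC -ler_pdivrMr// (le_trans (ltW md))//.
  by rewrite -[leLHS]expr1 ler_weXn2l// ler1n.
pose C := {ffun 'I_n.+1 -> 'I_(m.*2.+1)}.
have coord y : dot y y = 1 -> forall i, `|y 0 i| <= 1.
  move=> y1 i; rewrite -(@expr_le1 _ 2%N)// real_normK ?num_real// -y1.
  by rewrite /dot (bigD1 i)//= -expr2 lerDl sumr_ge0// => j _; rewrite -expr2 sqr_ge0.
pose cell y : C := [ffun i => inord (Num.truncn ((y 0 i + 1) * m%:R))].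
have cell_dist x y : dot x x = 1 -> dot y y = 1 -> cell x = cell y -> dist2 x y <= d.
  move=> x1 y1 xy; apply: le_trans hm.
  have bnd z : dot z z = 1 -> forall i,
      (Num.truncn ((z 0 i + 1) * m%:R : R)%R < m.*2.+1)%N /\ 0 <= (z 0 i + 1) * m%:R.
    move=> z1 i; have := coord z z1 i; rewrite ler_norml => /andP[h1 h2].
    have z0 : 0 <= (z 0 i + 1) * m%:R by rewrite mulr_ge0// -lerBlDr sub0r.
    split => //; rewrite ltnS -(ler_nat R) (@le_trans _ _ ((z 0 i + 1) * m%:R)) ?truncn_le//.
    by rewrite -muln2 natrM mulrC ler_wpM2l//; lra.
  have -> : n.+1%:R / m%:R ^+ 2 = \sum_(i < n.+1) (m%:R ^+ 2)^-1 :> R.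
    by rewrite sumr_const card_ord -[RHS]mulr_natl.
  apply: ler_sum => i _; rewrite -expr2 !mxE -div1r ler_pdivlMr ?exprn_gt0 ?ltr0n//.
  rewrite -exprMn -real_normK ?num_real// expr_le1 ?normr_ge0//.
  have [x2 x3] := bnd x x1 i; have [y2 y3] := bnd y y1 i.
  have xyi : Num.truncn ((x 0 i + 1) * m%:R) = Num.truncn ((y 0 i + 1) * m%:R).
    have := congr1 (fun c : C => nat_of_ord (c i)) xy; rewrite !ffunE !inordK//.
  have := truncn_itv x3; have := truncn_itv y3; rewrite -xyi.
  move: (Num.truncn _) => t /andP[t1 t2] /andP[t3 t4].
  rewrite (_ : (x 0 i - y 0 i) * m%:R = (x 0 i + 1) * m%:R - (y 0 i + 1) * m%:R); last by ring.
  by rewrite ler_norml; apply/andP; split; move: t2 t4; rewrite -natr1; lra.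
have /choice[p hp] : forall c : C, exists x : V, dot x x = 1 /\
    ((exists y, dot y y = 1 /\ cell y = c) -> cell x = c).
  move=> c; case: (pselect (exists y, dot y y = 1 /\ cell y = c)) => [[y [y1 yc]]|h].
    by exists y.
  exists (delta_mx 0 0); split => //.
  rewrite /dot (bigD1 ord0)//= !mxE !eqxx mulr1 big1 ?addr0// => i i0.
  by rewrite !mxE (negbTE i0) mulr0.
exists [seq p c | c <- enum C]; split.
  by move=> x /mapP[c _ ->]; have [] := hp c.
move=> y y1; have [p1 pc] := hp (cell y).
exists (p (cell y)); first by rewrite map_f// mem_enum.
by apply: cell_dist => //; apply: pc; exists y.
Qed.

(* A net of minimal cardinality and its image by an isometry satisfy Hall's
   condition: replacing a subset of the image by its neighbors gives a net. *)
Lemma symmetric_net d : 0 < d -> exists s : seq V,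
  [/\ forall x, x \in s -> dot x x = 1, s != [::] & forall a b, dot a a = 1 -> dot b b = 1 ->
    exists t, [/\ perm_eq t [seq dot b x | x <- s], size t = size s &
      forall i, `|[seq dot a x | x <- s]`_i - t`_i| <= d]].
Proof.
(* D bounds squared distances; by [dist2_le], two steps of size D give 4 D = d^2. *)
move=> d0; pose D := d ^+ 2 / 4.
have D0 : 0 < D by rewrite divr_gt0// exprn_gt0.
pose isnet N := `[< exists s, sphere_net D s /\ size s = N >].
have exN : exists N, isnet N.
  by have [s hs] := exists_sphere_net D0; exists (size s); apply/asboolP; exists s.
case: (ex_minnP exN) => N /asboolP[s [[s1 snet] sN]] Nmin.
have e1 : dot (delta_mx 0 0 : V) (delta_mx 0 0) = 1.
  rewrite /dot (bigD1 ord0)//= !mxE !eqxx mulr1 big1 ?addr0// => i i0.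
  by rewrite !mxE (negbTE i0) mulr0.
exists s; split => //.
  by have [x xs _] := snet _ e1; apply/eqP => s0; rewrite s0 in xs.
(* h takes a to b, so <a, x> = <b, h x>, and h x will be close to the point matched with x. *)
move=> a b a1 b1; pose h := reflection (a - b).
have ha : h a = b by rewrite /h reflection_swap// a1 b1.
pose P (i : 'I_(size s)) := s`_i.
have Ps i : P i \in s by rewrite mem_nth.
have [|f [finj fr]] := @hall _ (fun i j => dist2 (h (P i)) (P j) <= 4 * D).
  move=> S; rewrite leqNgt; apply/negP => NS.
  set r := (fun i j => _) in NS.
  pose s' := [seq h (P i) | i <- enum (~: S)] ++ [seq P j | j <- enum (neighbors r S)].
  have : isnet (size s').
    apply/asboolP; exists s'; split => //; split => [x|y y1].
      by rewrite mem_cat => /orP[] /mapP[i _ ->]; rewrite ?reflection_dot s1.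
    have [x xs xy] := snet (h y) ltac:(by rewrite reflection_dot).
    have xN : (index x s < size s)%N by rewrite index_mem.
    pose i := Ordinal xN; have iE : P i = x by rewrite /P nth_index.
    have iy : dist2 (h (P i)) y <= D.
      by rewrite iE -[y](reflectionK (a - b)) reflection_dist.
    case: (boolP (i \in S)) => iS; last first.
      exists (h (P i)) => //; rewrite mem_cat (map_f (fun i => h (P i)))//.
      by rewrite mem_enum inE.
    (* If i is in S, a net point near y is a neighbor of i, hence belongs to the new net. *)
    have [z zs zy] := snet y y1.
    have zN : (index z s < size s)%N by rewrite index_mem.
    pose j := Ordinal zN; have jE : P j = z by rewrite /P nth_index.
    exists (P j); last by rewrite jE.
    rewrite mem_cat; apply/orP; right; apply: map_f; rewrite mem_enum.
    apply: (mem_neighbors iS); rewrite /r (le_trans (dist2_le _ y _))//.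
    rewrite jE (dist2C y); move: iy zy; lra.
  move=> /Nmin; rewrite size_cat !size_map -!cardE -sN leqNgt => /negP; apply.
  by rewrite -[X in (_ < X)%N]card_ord -(cardsC S) addnC ltn_add2r.
exists [seq dot b (P (f i)) | i <- enum 'I_(size s)]; split.
- have -> : [seq dot b x | x <- s] = [seq dot b (P i) | i <- enum 'I_(size s)].
    rewrite (map_comp (dot b) P); congr map.
    apply: (@eq_from_nth _ 0) => [|i si]; first by rewrite size_map size_enum_ord.
    by rewrite (nth_map (Ordinal si)) ?size_enum_ord// /P nth_enum_ord.
  rewrite (map_comp (fun i => dot b (P i)) f); apply: perm_map.
  apply: uniq_perm; [by rewrite map_inj_uniq// fintype.enum_uniq|exact: fintype.enum_uniq|].
  move=> j; rewrite mem_enum.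
  by apply/mapP; have [g fg gf] := injF_bij finj; exists (g j); rewrite ?mem_enum ?gf.
- by rewrite size_map size_enum_ord.
- move=> i; have [si|si] := ltnP i (size s); last first.
    rewrite [X in _ - X]nth_default; last by rewrite size_map size_enum_ord.
    by rewrite nth_default ?size_map// subrr normr0 ltW.
  rewrite (nth_map 0)// (nth_map (Ordinal si)) ?size_enum_ord//.
  have -> : nth (Ordinal si) (enum 'I_(size s)) i = Ordinal si.
    by apply: val_inj; rewrite /= nth_enum_ord.
  set j := Ordinal si; rewrite -[s`_i]/(P j) -(reflection_dot (a - b)) -/h ha -dotBr.
  rewrite -(@ler_pXn2r _ 2%N) ?nnegrE ?(ltW d0)// real_normK ?num_real//.
  rewrite (le_trans (dot_unit_le _ b1))// (le_trans (fr j))// /D.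
  by rewrite mulrC divfK.
Qed.

End Sphere.

(** The norm M is almost equal to a constant M0 on the unit sphere, hence M / M0 almost Euclidean.
    Only finitely many lists of scalar products occur for the a in A, so vectors z_i of X realise N
    / M0 on them, and the y_j are the corresponding combinations of the z_i. *)
Theorem dvoretzky (R : realType) (X : completeNormedModType R) n (A : seq 'rV[R]_n.+1) e :
  infinite_dimensional X -> 0 < e ->
  exists y : 'I_n.+1 -> X, forall a, a \in A ->
    `| `|\sum_j a 0 j *: y j| - Num.sqrt (dot a a)| < e.
Proof.
move=> Xinf e0.
pose L := 1 + \sum_(a <- A) Num.sqrt (dot a a).
have L0 : 0 < L by rewrite ltr_pwDl// sumr_ge0// => a _; exact: sqrtr_ge0.
have aL a : a \in A -> Num.sqrt (dot a a) <= L.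
  by move=> aA; rewrite /L (big_rem a)//= addrCA lerDl addr_ge0// sumr_ge0.
(* M / M0 will be within 2 eta of 1 on the sphere, hence within 2 eta L = e / 2 of the Euclidean
   norm on A. *)
pose eta := e / (4 * L); have eta0 : 0 < eta by rewrite divr_gt0// mulr_gt0.
pose d := eta / n.+1%:R; have d0 : 0 < d by rewrite divr_gt0.
have [s [s1 sN0 hs]] := symmetric_net n d0.
have [N [spN soN mN N1 sym]] := exists_symmetric_model (size s) Xinf eta0.
pose M a := N [seq dot a x | x <- s].
pose one := nseq (size s) (1 : R).
have MZ c a : M (c *: a) = `|c| * M a.
  rewrite /M -spreadingZ// /lscale -map_comp; congr (N _).
  by apply: eq_map => x /=; rewrite dotZl.
(* The permutation costs the factor 1 + eta; moving each entry by at most d costs d N (1, ..., 1),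
   as N is solid. *)
have Msym a b : dot a a = 1 -> dot b b = 1 -> M a <= (1 + eta) * M b + d * N one.
  move=> a1 b1; have [t [pt st ht]] := hs a b a1 b1.
  have tM : N t <= (1 + eta) * M b by apply: sym; rewrite ?st.
  apply: le_trans (lerD tM (lexx _)).
  have := spreading_swap spN [::] [::] (x := [seq dot a x | x <- s]) (y := t).
  rewrite size_map st /= !cats0 => /(_ erefl) h; rewrite (le_trans h)// lerD2l.
  rewrite -[d](gtr0_norm d0) -spreadingZ//; apply: soN.
    by rewrite size_ladd !size_lscale size_map st size_nseq minnn.
  move=> i; have [si|si] := ltnP i (size s); last first.
    by rewrite !nth_default// ?size_ladd ?size_lscale ?size_map ?st ?size_nseq ?minnn.
  rewrite [nth 0 (lscale d one) i](nth_map 0) ?size_nseq// nth_nseq si mulr1.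
  rewrite (gtr0_norm d0) (nth_map (0, 0)) ?size_zip ?size_lscale ?size_map ?st ?minnn//.
  rewrite nth_zip ?size_lscale ?size_map ?st//= (nth_map 0 _ (fun x => -1 * x)) ?st//.
  by rewrite mulN1r ht.
have one0 : 0 < N one.
  rewrite (lt_le_trans ltr01)// /one; case: (s) sN0 => // x r _.
  by have := solid_sub spN soN N1 [::] 1 (nseq (size r) 1); rewrite normr1.
(* The additive error has to be compared with M. A unit vector x satisfies 1 = \sum_j x_j^2 <=
   \sum_j |x_j|, so N (1, ..., 1) is at most the sum of the n+1 values M e_j. This explains the
   choice d = eta / (n+1). *)
have [j hj] : exists j : 'I_n.+1, N one <= n.+1%:R * M (delta_mx 0 j).
  have dotE j0 (x : 'rV[R]_n.+1) : dot (delta_mx 0 j0) x = x 0 j0.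
    rewrite /dot (bigD1 j0)//= !mxE !eqxx mul1r big1 ?addr0// => i i0.
    by rewrite !mxE (negbTE i0) mul0r.
  have le_sum : N one <= \sum_(j0 < n.+1) M (delta_mx 0 j0).
    apply: (@le_trans _ _ (N (mkseq (fun i => \sum_(j0 < n.+1) `|s`_i 0 j0|) (size s)))).
      apply: soN; first by rewrite size_nseq size_mkseq.
      move=> i; have [si|si] := ltnP i (size s); last first.
        by rewrite !nth_default ?size_mkseq ?size_nseq.
      rewrite nth_nseq si nth_mkseq// normr1 ger0_norm ?sumr_ge0//.
      have x1 := s1 _ (mem_nth 0 si); rewrite -[leLHS]x1 /dot.
      apply: ler_sum => j0 _; rewrite -expr2 -real_normK ?num_real//.
      rewrite expr2 ler_piMl// -(@expr_le1 _ 2%N)// real_normK ?num_real//.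
      rewrite -[leRHS]x1 /dot (bigD1 j0)//= -expr2 lerDl sumr_ge0// => k _.
      by rewrite -expr2 sqr_ge0.
    apply: le_trans (spreading_sum spN _ _ (fun (j0 : 'I_n.+1) i => `|s`_i 0 j0|)) _.
    apply: ler_sum => j0 _; apply: soN; first by rewrite size_mkseq size_map.
    move=> i; have [si|si] := ltnP i (size s); last first.
      by rewrite !nth_default ?size_mkseq ?size_map.
    by rewrite nth_mkseq// (nth_map 0)// dotE normr_id.
  case: (@arg_maxP _ _ _ (ord0 : 'I_n.+1) xpredT (fun j0 => M (delta_mx 0 j0)) isT) => j _ hj.
  exists j; rewrite (le_trans le_sum)//.
  apply: (@le_trans _ _ (\sum_(j0 < n.+1) M (delta_mx 0 j))).
    by apply: ler_sum => j0 _; exact: hj.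
  by rewrite sumr_const card_ord -[leLHS]mulr_natl.
have e1 j0 : dot (delta_mx 0 j0 : 'rV[R]_n.+1) (delta_mx 0 j0) = 1.
  rewrite /dot (bigD1 j0)//= !mxE !eqxx mulr1 big1 ?addr0// => i i0.
  by rewrite !mxE (negbTE i0) mulr0.
pose M0 := M (delta_mx 0 j).
have M00 : 0 < M0 by rewrite -(pmulr_rgt0 _ (ltr0n R n.+1 : 0 < n.+1%:R)) (lt_le_trans one0).
have dM0 : d * N one <= eta * M0.
  rewrite (le_trans (ler_wpM2l (ltW d0) hj))// /d -/M0.
  by rewrite mulrA divfK// pnatr_eq0.
have Mclose a : a \in A -> `|M a / M0 - Num.sqrt (dot a a)| <= e / 2.
  move=> aA; set l := Num.sqrt _.
  have l0 : 0 <= l by exact: sqrtr_ge0.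
  have [lz|lz] := eqVneq l 0.
    have a0 : a = 0.
      by apply: dot_eq0; rewrite -[dot a a]sqr_sqrtr ?dot_ge0// -/l lz expr0n.
    by rewrite a0 -(scale0r a) MZ normr0 mul0r mul0r lz subrr normr0 divr_ge0 ?ltW.
  pose b := l^-1 *: a.
  have b1 : dot b b = 1.
    rewrite /b dotZl dotZr -[dot a a]sqr_sqrtr ?dot_ge0// -/l; by field.
  have -> : M a = l * M b.
    by rewrite -[l in RHS]ger0_norm// -MZ /b scalerA mulfV// scale1r.
  have h1 := Msym b (delta_mx 0 j) b1 (e1 j).
  have h2 := Msym (delta_mx 0 j) b (e1 j) b1.
  rewrite -/M0 in h1 h2.
  rewrite -[X in _ - X]mulr1 -mulrA -mulrBr normrM ger0_norm//.
  have hM : `|M b / M0 - 1| <= 2 * eta.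
    have x1 : M b / M0 <= 1 + 2 * eta by rewrite ler_pdivrMr//; lra.
    have x2 : 1 <= (1 + eta) * (M b / M0) + eta.
      rewrite -(ler_pM2r M00) mul1r mulrDl -mulrA divfK ?gt_eqF//; lra.
    by rewrite ler_norml; apply/andP; split; nra.
  rewrite (le_trans (ler_pM l0 (normr_ge0 _) (aL a aA) hM))//.
  by rewrite le_eqVlt /eta; apply/orP; left; apply/eqP; field; rewrite gt_eqF.
have [z hz] := modeled_scale M00 mN [seq [seq dot a x | x <- s] | a <- A] (divr_gt0 e0 (ltr0n R 2)).
exists (fun j0 => \sum_(i < size s) s`_i 0 j0 *: z i) => a aA.
have -> : \sum_j0 a 0 j0 *: (\sum_(i < size s) s`_i 0 j0 *: z i) =
    \sum_(i < size s) dot a s`_i *: z i.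
  under eq_bigr do rewrite scaler_sumr.
  rewrite exchange_big; apply: eq_bigr => i _.
  by rewrite /dot scaler_suml; apply: eq_bigr => k _; rewrite scalerA.
have := hz _ (map_f _ aA); rewrite size_map.
under eq_bigr do rewrite (nth_map 0)//.
move=> h; rewrite (splitr e) (le_lt_trans (ler_distD (M a / M0) _ _))//.
by rewrite ltr_leD// Mclose.
Qed.

(** * Pseudonorms *)

(** F is the filter of basic neighborhoods; the topology of pointwise convergence is a supremum of
    topologies, so F --> mu is checked at one v at a time. *)
Lemma nbhs_pseudonorms (R : realType) (mu : pseudonorms R) (B : set (pseudonorms R)) :
  nbhs mu B -> exists (vs : seq {poly rat}) e, 0 < e /\ forall nu : pseudonorms R,
    (forall v, v \in vs -> `|set_val nu v - set_val mu v| < e) -> B nu.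
Proof.
pose F : set_system {ptws {poly rat} -> R} := [set A | exists (vs : seq {poly rat}) e,
  0 < e /\ forall f : {ptws {poly rat} -> R},
    (forall v, v \in vs -> `|f v - set_val mu v| < e) -> A f].
have FF : Filter F.
  split.
  - by exists [::], 1.
  - move=> A C [vs [e [e0 h]]] [ws [d [d0 k]]]; exists (vs ++ ws), (Num.min e d).
    split; first by rewrite lt_min e0.
    move=> f hf; split.
      by apply: h => v vvs; have := hf v; rewrite mem_cat vvs lt_min => /(_ isT)/andP[].
    by apply: k => v vws; have := hf v; rewrite mem_cat vws orbT lt_min => /(_ isT)/andP[].
  - by move=> A C AC [vs [e [e0 h]]]; exists vs, e; split => // f /h /AC.
have Fmu : F --> (set_val mu : {ptws {poly rat} -> R}).
  apply/cvg_sup => v A [_ [[W oW <-] Wmu WA]].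
  have /nbhs_ballP[e e0 eW] : nbhs (set_val mu v) W by exact: open_nbhs_nbhs.
  exists [:: v], e; split => // f /(_ v (mem_head _ _)) fv; apply: WA; apply: eW.
  by rewrite -ball_normE /= distrC.
move=> [_ [[W oW <-] Wmu WB]].
have [vs [e [e0 h]]] : F W by apply: Fmu; exact: open_nbhs_nbhs.
by exists vs, e; split => // nu hnu; apply: WB; exact: h.
Qed.

(** * Extending isometries to the completion *)

Section CompletionLift.
Context (R : realType) (E : lmodType R) (p : seminorm E) (X : completeNormedModType R).
Context (J : {linear E -> X}) (Jp : forall x, `|J x| = p x).

Let J_cvg (u : cauchySeq p) : cvgn (J \o u).
Proof.
apply: cauchy_cvg; apply: cauchy_exP => e e0.
have /asboolP/(_ _ e0)[N hN] := cauchySeqP u.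
exists (J (u N)); exists N => // n /= Nn.
by rewrite -ball_normE /= -linearB Jp hN.
Qed.

Definition completion_lift (q : completion p) : X := limn (J \o repr q).

Lemma completion_lift_cclass u : completion_lift (cclass u) = limn (J \o u).
Proof.
have /null_predP w0 := repr_cclass u.
have h : (J \o repr (cclass u)) n - (J \o u) n @[n --> \oo] --> (0 : X).
  apply: norm_cvg0; apply: cvg_trans w0; apply: near_eq_cvg; apply: nearW => n /=.
  by rewrite -linearB Jp.
have c : (J \o u) n + ((J \o repr (cclass u)) n - (J \o u) n) @[n --> \oo] --> limn (J \o u).
  by rewrite -[X in _ --> X]addr0; apply: cvgD; [exact: J_cvg|exact: h].
rewrite /completion_lift; apply/cvg_lim => //.
apply: cvg_trans c; apply: near_eq_cvg; apply: nearW => n.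
by rewrite addrC subrK.
Qed.

Lemma completion_lift_linear : linear completion_lift.
Proof.
move=> a q r; have [u ->] := cclassP q; have [v ->] := cclassP r.
rewrite -cclassZ -cclassD !completion_lift_cclass; apply/cvg_lim => //.
rewrite (_ : J \o _ = fun n => a *: (J \o u) n + (J \o v) n).
  by apply: cvgD; [apply: cvgZl_tmp; exact: J_cvg|exact: J_cvg].
by apply/funext => n /=; rewrite -linearP.
Qed.

HB.instance Definition _ :=
  GRing.isLinear.Build R (completion p) X _ completion_lift completion_lift_linear.

Lemma completion_lift_norm q : `|completion_lift q| = `|q|.
Proof.
have [u ->] := cclassP q; rewrite completion_lift_cclass cclass_norm.
apply/esym/cvg_lim => //; rewrite (_ : p \o u = fun n => `|(J \o u) n|).
  by apply: cvg_norm; exact: J_cvg.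
by apply/funext => n /=; rewrite Jp.
Qed.

Lemma completion_isometric : (forall x e, 0 < e -> exists v, `|x - J v| < e) ->
  isometric (completion p) X.
Proof.
move=> Jd; exists completion_lift; split; last exact: completion_lift_norm.
have inj : injective completion_lift.
  move=> q r qr; apply/eqP; rewrite -subr_eq0 -normr_eq0 -completion_lift_norm.
  by rewrite linearB /= qr subrr normr0.
have surj x : exists q, completion_lift q = x.
  have /choice[v hv] : forall n : nat, exists v, `|x - J v| < n.+1%:R^-1.
    by move=> n; exact: Jd.
  have vc : v \in cauchy_pred p.
    apply/asboolP => e e0.
    have [N _ hN] : \forall n \near \oo, (n.+1%:R^-1 : R) < e / 2.
      by apply: near_infty_natSinv_lt (PosNum _); rewrite divr_gt0.
    exists N => m n Nm Nn; rewrite -Jp linearB/= (splitr e).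
    rewrite (le_lt_trans (ler_distD x _ _))// distrC ltrD//.
      by rewrite (lt_trans (hv m))// hN.
    by rewrite (lt_trans (hv n))// hN.
  exists (cclass (CauchySeq vc)); rewrite completion_lift_cclass; apply/cvg_lim => //=.
  apply/cvgrPdist_lt => e e0; near=> n => /=; rewrite (lt_trans (hv n))//.
  near: n; exact: near_infty_natSinv_lt (PosNum e0).
have /choice[g hg] := surj; exists g => [q|x]; last exact: hg.
by apply: inj; rewrite hg.
Unshelve. all: by end_near. Qed.

End CompletionLift.

(** * Linearly independent sequences with dense range *)

Section IndependentSequence.
Context (R : realType) (X : normedModType R).

Definition spanned (s : seq X) (x : X) :=
  exists a : nat -> R, x = \sum_(i < size s) a i *: s`_i.

(** If x lies in the span of s, it is moved slightly towards a vector w outside the span. *)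
Lemma not_spanned_dense (s : seq X) x e : infinite_dimensional X -> 0 < e ->
  exists z, `|z - x| < e /\ ~ spanned s z.
Proof.
move=> Xinf e0; case: (pselect (spanned s x)) => [[a xa]|xs]; last first.
  by exists x; rewrite subrr normr0.
have [w nw] : exists w, ~ spanned s w.
  apply: contrapT => h; apply: Xinf; exists (size s), (fun i => s`_i) => w.
  have [b wb] : spanned s w by apply: contrapT => nw; apply: h; exists w.
  by exists b.
pose t := e / 2 / (`|w| + 1).
have w1 : 0 < `|w| + 1 by rewrite ltr_wpDl.
have t0 : 0 < t by rewrite !divr_gt0.
exists (x + t *: w); split.
  rewrite addrC addKr normrZ gtr0_norm// /t.
  rewrite mulrAC ltr_pdivrMr//.
  have : 0 <= e * `|w| by rewrite mulr_ge0// ltW.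
  lra.
move=> [b hb]; apply: nw; exists (fun i => t^-1 * (b i - a i)).
have tw : t *: w = \sum_(i < size s) (b i - a i) *: s`_i.
  rewrite -[LHS](addKr x) hb xa addrC -sumrB; apply: eq_bigr => i _.
  by rewrite scalerBl.
rewrite -[LHS](scalerK (lt0r_neq0 t0)) tw scaler_sumr.
by apply: eq_bigr => i _; rewrite scalerA.
Qed.

Lemma independent_perturbation (x : nat -> X) (e : nat -> R) :
  infinite_dimensional X -> (forall i, 0 < e i) ->
  exists y : nat -> X, (forall i, `|y i - x i| < e i) /\
    forall i, ~ spanned (mkseq y i) (y i).
Proof.
move=> Xinf e0.
have /choice[f hf] : forall si : seq X * nat, exists z, `|z - x si.2| < e si.2 /\
    ~ spanned si.1 z.
  by move=> [s i]; exact: not_spanned_dense.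
pose Y := fix Y n := if n is m.+1 then rcons (Y m) (f (Y m, m)) else [::].
have YE n : Y n = mkseq (fun i => f (Y i, i)) n.
  by elim: n => // n IH; rewrite mkseqS -IH.
exists (fun i => f (Y i, i)); split => i; have [h1 h2] := hf (Y i, i) => //.
by rewrite -YE.
Qed.

Lemma independent_comb (y : nat -> X) (p : {poly R}) :
  (forall i, ~ spanned (mkseq y i) (y i)) ->
  \sum_(i < size p) p`_i *: y i = 0 -> p = 0.
Proof.
move=> yi; have [//|p0] := eqVneq p 0.
case sp : (size p) => [|m]; first by move/eqP: sp; rewrite size_poly_eq0 (negbTE p0).
have lp : p`_m != 0 by rewrite -[m]/(m.+1.-1) -sp -/(lead_coef p) lead_coef_eq0.
rewrite big_ord_recr /= => h; exfalso; apply: (yi m).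
exists (fun i => - (p`_m)^-1 * p`_i); rewrite size_mkseq.
rewrite -[LHS](scalerK lp); move/eqP: h; rewrite addrC addr_eq0 => /eqP ->.
rewrite scalerN -scaleNr scaler_sumr; apply: eq_bigr => i _.
by rewrite nth_mkseq// scalerA.
Qed.

Lemma separable_sequence : separable X ->
  exists d : nat -> X, forall x e, 0 < e -> exists j, `|x - d j| < e.
Proof.
move=> [D [/countable_injP[f finj] Dd]].
have /choice[d hd] : forall n, exists z, (exists2 x, D x & f x = n) -> D z /\ f z = n.
  move=> n; case: (pselect (exists2 x, D x & f x = n)) => [[x Dx fx]|h]; first by exists x.
  by exists 0.
exists d => x e e0.
have [z [xz Dz]] : (ball x e `&` D) !=set0.
  by apply: Dd; [exists x; exact: ballxx|exact: ball_open].
exists (f z); have [Dd' fd] := hd (f z) (ex_intro2 _ _ z Dz erefl).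
have -> : d (f z) = z by apply: finj; rewrite ?inE.
by move: xz; rewrite -ball_normE.
Qed.

(** From n on, the terms of a dense sequence are perturbed by less than 1/(i+1); since each of them
    recurs at arbitrarily large i, density survives the perturbation. *)
Lemma independent_dense_extension (x : nat -> X) n e :
  infinite_dimensional X -> separable X -> 0 < e ->
  exists y : nat -> X, [/\ forall i, (i < n)%N -> `|y i - x i| < e,
    forall i, ~ spanned (mkseq y i) (y i) &
    forall z d, 0 < d -> exists i, `|z - y i| < d].
Proof.
move=> Xinf /separable_sequence[s hs] e0.
(* [logn 2 i.+1] takes every value infinitely often *)
pose x' i := if (i < n)%N then x i else s (logn 2 i.+1).
have [y [yx yi]] := @independent_perturbation x' (fun i => Num.min e i.+1%:R^-1) Xinf
  (fun i => ltac:(by rewrite lt_min e0 /=)).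
exists y; split => //.
  by move=> i ni; have := yx i; rewrite /x' ni lt_min => /andP[].
move=> z d d0; have d2 : 0 < d / 2 by rewrite divr_gt0.
have [j hj] := hs z _ d2.
have [c hc] : exists c : nat, (d / 2)^-1 < c%:R.
  by exists (Num.truncn (d / 2)^-1).+1; rewrite truncnS_gt.
(* k has 2-adic valuation j and exceeds both n and 2/d; the index used is k - 1. *)
pose k := (2 ^ j * (maxn n c).*2.+1)%N.
have k0 : (0 < k)%N by rewrite muln_gt0 expn_gt0.
have lk : logn 2 k = j.
  rewrite lognM ?expn_gt0// pfactorK// logn_coprime ?addn0//.
  by rewrite coprime2n /= odd_double.
have kc : (maxn n c < k)%N.
  rewrite (leq_trans (_ : _ <= (maxn n c).*2.+1)%N) ?leq_pmull ?expn_gt0//.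
  by rewrite ltnS -addnn leq_addr.
exists k.-1; have := yx k.-1; rewrite /x' prednK// lk.
have -> : (k <= n)%N = false.
  by apply/negbTE; rewrite -ltnNge (leq_ltn_trans (leq_maxl n c) kc).
rewrite lt_min => /andP[_ yk].
rewrite (splitr d) (le_lt_trans (ler_distD (s j) _ _))// ltrD// distrC (lt_le_trans yk)//.
rewrite -[leRHS]invrK lef_pV2 ?posrE ?invr_gt0 ?ltr0n//.
by rewrite (le_trans (ltW hc))// ler_nat (leq_trans (leq_maxr n c))// ltnW.
Qed.

End IndependentSequence.

Section PolyComb.
Context (R : realType) (X : normedModType R) (y : nat -> X).

Definition poly_comb (p : {poly R}) : X := \sum_(i < size p) p`_i *: y i.

Lemma poly_combE n (p : {poly R}) : (size p <= n)%N -> poly_comb p = \sum_(i < n) p`_i *: y i.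
Proof.
move=> pn; rewrite /poly_comb (big_ord_widen n (fun i => p`_i *: y i))//.
rewrite big_mkcond/=; apply: eq_bigr => i _; case: ltnP => // pi.
by rewrite nth_default// scale0r.
Qed.

Lemma poly_comb_linear : linear poly_comb.
Proof.
move=> a p q; set n := maxn (size p) (size q).
have np : (size p <= n)%N by exact: leq_maxl.
have nq : (size q <= n)%N by exact: leq_maxr.
rewrite !(@poly_combE n)//; last first.
  by rewrite (leq_trans (size_polyD _ _))// geq_max nq (leq_trans (size_scale_leq _ _)).
rewrite scaler_sumr -big_split/=; apply: eq_bigr => i _.
by rewrite coefD coefZ scalerDl scalerA.
Qed.

HB.instance Definition _ :=
  GRing.isLinear.Build R {poly R} X _ poly_comb poly_comb_linear.

Lemma poly_combXn i : poly_comb 'X^i = y i.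
Proof.
rewrite (@poly_combE i.+1) ?size_polyXn// big_ord_recr/= big1 ?add0r.
  by rewrite coefXn eqxx scale1r.
by move=> j _; rewrite coefXn ltn_eqF// scale0r.
Qed.

End PolyComb.

(** x |-> |J x| is a seminorm on c00, so [extension_unique] identifies it with the extension of its
    restriction to V. *)
Lemma pseudonorm_of_linear (R : realType) (X : normedModType R)
    (J : {linear {poly R} -> X}) :
  exists nu : pseudonorms R, forall x, extension nu x = `|J x|.
Proof.
pose f v := `|J (map_poly ratr v)|.
have fP : pseudonorms R f.
  split => [v|q v|v w]; rewrite /f ?normr_ge0//.
    by rewrite map_polyZ/= linearZ/= normrZ ratr_norm.
  by rewrite rmorphD linearD ler_normD.
pose nu : pseudonorms R := exist _ f (mem_set fP).
have pD x z : `|J (x + z)| <= `|J x| + `|J z| by rewrite linearD ler_normD.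
have pZ a x : `|J (a *: x)| = `|a| * `|J x| by rewrite linearZ/= normrZ.
pose p := Seminorm (fun x => normr_ge0 (J x)) pZ pD.
by exists nu => x; rewrite -(@extension_unique R nu p).
Qed.

Lemma isometric_infinite_dimensional (R : realType) (E F : normedModType R) :
  isometric E F -> infinite_dimensional F -> infinite_dimensional E.
Proof.
move=> [T [[S TS ST] _]] Finf [n [e he]]; apply: Finf; exists n, (T \o e) => x.
have [a ha] := he (S x); exists a; rewrite -[LHS]ST ha linear_sum.
by apply: eq_bigr => i _; rewrite linearZ.
Qed.

Lemma ell2_truncation (R : realType) (x : ell2 R) e : 0 < e ->
  \forall n \near \oo, `|Num.sqrt (\sum_(k < n) x k ^+ 2) - `|x| | < e.
Proof.
move=> e0.
have c : Num.sqrt (series (fun k => x k ^+ 2) n) @[n --> \oo] --> `|x|.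
  by apply: continuous_cvg; [exact: sqrt_continuous|exact: ell2_cvg].
have /cvgrPdist_lt/(_ _ e0) := c; apply: filterS => n.
by rewrite distrC /series/= big_mkord.
Qed.

Theorem corollary1p11 (R : realType) (X : completeNormedModType R)
    (X_separable : separable X) (X_infinite : infinite_dimensional X)
    (I : set (pseudonorms R))
    (I_cases : [\/ I = B_class R, I = P_infty R | I = [set: pseudonorms R]]) :
  [set mu | I mu /\ isometric (Xspace mu) (ell2 R)] `<=`
  closure [set mu | I mu /\ isometric (Xspace mu) X] `&` I.
Proof.
move=> mu [Imu [T [_ Tn]]]; split => // B /nbhs_pseudonorms[vs [e [e0 hB]]].
pose t (v : {poly rat}) : ell2 R := T (completion_in (extension mu) (map_poly ratr v)).
have tn v : `|t v| = set_val mu v.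
  by rewrite Tn completion_in_norm; exact: extension_ratr.
pose L : nat := \max_(v <- vs) size v.
have vL v : v \in vs -> (size v <= L)%N by move=> vvs; exact: leq_bigmax_seq.
have tE v : v \in vs -> t v = \sum_(i < L) ratr v`_i *: t 'X^i.
  move=> /vL vl; rewrite /t -[v in LHS]coefK poly_def.
  rewrite (big_ord_widen L (fun i => v`_i *: 'X^i))// big_mkcond/=.
  rewrite !linear_sum/=; apply: eq_bigr => i _; case: ltnP => vi.
    by rewrite map_polyZ/= !linearZ.
  by rewrite map_poly0 nth_default// rmorph0 scale0r !linear0.
(* The three errors: truncation in l_2, Dvoretzky's theorem, and the perturbation of x into y. *)
have e3 : 0 < e / 3 by rewrite divr_gt0.
have [m hm] : exists m : nat, forall v, v \in vs ->
    `|Num.sqrt (\sum_(k < m.+1) t v k ^+ 2) - `|t v| | < e / 3.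
  have [m _ hm] := filter_seq vs _ (fun v => ell2_truncation (t v) e3).
  by exists m; apply: hm => /=.
(* Dvoretzky's theorem is applied to the truncations of the [t v]. The [x i] below come from the
   truncations of the [t 'X^i], so by linearity their combinations are the vectors it controls. *)
pose A := [seq \row_(k < m.+1) t v k | v <- vs].
have [z hz] := dvoretzky A X_infinite e3.
pose x i := \sum_(k < m.+1) (t 'X^i) k *: z k.
(* S bounds the sum of the moduli of the coefficients of each v in [vs]: moving the [x i] by less
   than e/3/(S+1) moves the combinations by less than e/3. *)
pose S := \sum_(v <- vs) \sum_(i < L) `|ratr v`_i : R|.
have S0 : 0 <= S by rewrite !sumr_ge0// => v _; rewrite sumr_ge0.
have d0 : 0 < e / 3 / (S + 1) by rewrite divr_gt0// ltr_wpDl.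
have [y [yx yi yd]] := independent_dense_extension x L X_infinite X_separable d0.
have [nu nuE] := pseudonorm_of_linear (poly_comb y).
have Xnu : isometric (Xspace nu) X.
  apply: (@completion_isometric _ _ _ _ (poly_comb y)) => [w|w d dp]; first by rewrite nuE.
  by have [i hi] := yd w d dp; exists ('X^i : {poly R}); rewrite /= poly_combXn.
have nuinf : P_infty R nu by exact: isometric_infinite_dimensional Xnu X_infinite.
exists nu; split.
  (* nu lies in the smallest of the three classes, so one construction serves them all. *)
  split=> //; case: I_cases => -> //; split => // p /eqP.
  by rewrite nuE normr_eq0 => /eqP; exact: independent_comb.
apply: hB => v vvs.
rewrite -tn -[set_val nu v]extension_ratr [extension_fun _ _]nuE.
set s := \sum_(k < m.+1) t v k *: z k.
have h1 : `| `|s| - Num.sqrt (\sum_(k < m.+1) t v k ^+ 2)| < e / 3.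
  have := hz (\row_(k < m.+1) t v k) (map_f _ vvs).
  have -> : dot (\row_(k < m.+1) t v k) (\row_(k < m.+1) t v k) = \sum_(k < m.+1) t v k ^+ 2.
    by apply: eq_bigr => k _; rewrite !mxE expr2.
  by congr (`| `|_| - _| < _); apply: eq_bigr => k _; rewrite mxE.
have sE : s = \sum_(i < L) ratr v`_i *: x i.
  rewrite /s tE//.
  transitivity (\sum_(k < m.+1) \sum_(i < L) (ratr v`_i * t 'X^i k) *: z k).
    apply: eq_bigr => k _; rewrite -scaler_suml; congr (_ *: _).
    by elim/big_ind2 : _ => // a b c d <- <-.
  rewrite exchange_big/=; apply: eq_bigr => i _.
  by rewrite scaler_sumr; apply: eq_bigr => k _; rewrite scalerA.
have h2 : `| `|poly_comb y (map_poly ratr v)| - `|s| | < e / 3.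
  rewrite (le_lt_trans (ler_dist_dist _ _))// sE (@poly_combE _ _ _ L) ?size_map_poly ?vL//.
  rewrite -sumrB.
  apply: (@le_lt_trans _ _ (S * (e / 3 / (S + 1)))).
    apply: (le_trans (ler_norm_sum _ _ _)).
    apply: (@le_trans _ _ ((\sum_(i < L) `|ratr v`_i : R|) * (e / 3 / (S + 1)))).
      rewrite mulr_suml; apply: ler_sum => i _.
      by rewrite coef_map -scalerBr normrZ ler_wpM2l// ltW// yx.
    rewrite ler_wpM2r ?(ltW d0)// /S (big_rem v)//= lerDl sumr_ge0// => w _.
    by rewrite sumr_ge0.
  by rewrite mulrA ltr_pdivrMr ?ltr_wpDl// [ltLHS]mulrC ltr_pM2l// ltrDl.
have h3 := hm v vvs.
move: h1 h2 h3; rewrite !ltr_norml => /andP[? ?] /andP[? ?] /andP[? ?].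
apply/andP; split; lra.
Qed.
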